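(* Let $\xi>1$ and $r_0\geq 3+2\xi$. Let $(M^n,g)$ be a complete Riemannian manifold with center $o\in M$, and let $S\subset M$. If $g$ is radially $\epsilon$-close to hyperbolic on $S$ (with respect to $o$) with charts of excess $\xi$, then the warp forced metric $\mathcal{W}_{r_0}g$ is radially $\eta$-close to hyperbolic on $S-\bar B_{r_0-1-\xi}$ (with respect to $o$) with charts of excess $\xi-1$, provided $\eta\geq e^{27+12\xi}\big(e^{-2r_0}+\epsilon\big)$.
   Context: Center: a complete Riemannian manifold $(M^n,g)$ has center $o\in M$ if $\exp_o:T_oM\to M$ is a diffeomorphism. Via $\exp_o$ (geodesic polar coordinates) one identifies $M-\{o\}=\mathbb{S}^{n-1}\times\mathbb{R}^+$ and writes $g=g_r+dr^2$ there, where $r$ is the $g$-distance to $o$ and $g_r$ is a metric on $\mathbb{S}^{n-1}$ depending on $r$. $B_r$ and $\bar B_r$ denote the open and closed $g$-balls of radius $r$ centered at $o$. Warp forcing: a smooth function $\rho:\mathbb{R}\to[0,1]$ is fixed once and for all, with $\rho(t)=0$ for $t\leq 0$, $\rho(t)=1$ for $t\geq 1$, and $\rho$ constant near $0$ and near $1$. For $r_0>0$ let $\rho_{r_0}(t)=\rho(2t-2r_0)$, regarded as a function on $M-\{o\}$ through $t=r$. Define on $M-\{o\}$ the warped product metric $$\bar g_{r_0}=\sinh^2(r)\Big(\frac{1}{\sinh^2(r_0)}\Big)g_{r_0}+dr^2,$$ where $g_{r_0}$ is the metric $g_r$ on $\mathbb{S}^{n-1}$ at $r=r_0$. The warp forced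 metric on $M-\{o\}$ is $$\mathcal{W}_{r_0}g=(1-\rho_{r_0})\,\bar g_{r_0}+\rho_{r_0}\,g,$$ so that $\mathcal{W}_{r_0}g=\bar g_{r_0}$ on $\bar B_{r_0}-\{o\}$ and $\mathcal{W}_{r_0}g=g$ outside $B_{r_0+\frac12}$. Models: $\mathbb{B}\subset\mathbb{R}^{n-1}$ is the open unit ball with flat metric $\sigma_{\mathbb{R}^{n-1}}$; for $\xi\geq 0$, $I_\xi=(-1-\xi,1+\xi)$ and $\mathbb{T}_\xi=\mathbb{B}\times I_\xi\subset\mathbb{R}^n$, with hyperbolic metric $\sigma=e^{2t}\sigma_{\mathbb{R}^{n-1}}+dt^2$. The number $\xi$ is called the excess. $C^2$-norm: for an open $A\subset\mathbb{R}^n$ and $f=(f_1,\dots,f_l):A\to\mathbb{R}^l$, $|f|_{C^2(A)}=\sup\{|f_i(z)|,|\partial_jf_i(z)|,|\partial_{j,k}f_i(z)|\}$ over $z\in A$, $1\leq i\leq l$, $1\leq j,k\leq n$. For symmetric 2-tensors $g$ on $A$ (metrics and their differences) the norm is that of the $\mathbb{R}^{n^2}$-valued function $z\mapsto(g_{ij}(z))$ of components in the canonical basis. Radially $\epsilon$-close: a metric $h$ (here $h=g$ or $h=\mathcal{W}_{r_0}g$) is radially $\epsilon$-close to hyperbolic on a set $S$ with charts of excess $\xi$ if for every $p\in S$ there is a chart $\phi:\mathbb{T}_\xi\to M-\{o\}=\mathbb{S}^{n-1}\times\mathbb{R}^+$ (a diffeomorphism onto an open subset) with $\phi(0,0)=p$,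 with $|\phi^*h-\sigma|_{C^2(\mathbb{T}_\xi)}<\epsilon$, and of the form $\phi(x,t)=(\phi_1(x),t+a)$, where $a$ is a constant depending on $\phi$ and $\phi_1:\mathbb{B}\to\mathbb{S}^{n-1}$ is independent of $t$. The number $\xi$ is the same for all $p\in S$. The product structure on $M-\{o\}$ is always the one given by the original metric $g$. *)

(* Defs.v *)
From mathcomp Require Import all_boot all_order all_algebra.
From mathcomp Require Import all_classical all_reals all_analysis.

Set Implicit Arguments.
Unset Strict Implicit.
Unset Printing Implicit Defensive.

Import Order.TTheory GRing.Theory Num.Theory.
Import numFieldNormedType.Exports.

Local Open Scope classical_set_scope.
Local Open Scope ring_scope.

Definition sinh (R : realType) (x : R) : R := (expR x - expR (- x)) / 2.

(** * Calculus on open subsets of R^n *)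

(* R^n is 'rV[R]_n; linear maps act on row vectors from the right, so that
   ('J F x) i j is the partial derivative of the j-th component of F in the
   i-th direction, and a bilinear form with matrix A sends (v, w) to v A w^T. *)
Definition basis_vec (R : realType) (n : nat) (i : 'I_n) : 'rV[R]_n :=
  delta_mx 0 i.

Definition partial (R : realType) (n : nat) (V : normedModType R) (i : 'I_n)
    (f : 'rV[R]_n -> V) : 'rV[R]_n -> V :=
  fun x => 'D_(basis_vec R i) f x.

Definition partials (R : realType) (n : nat) (V : normedModType R)
    (s : seq 'I_n) (f : 'rV[R]_n -> V) : 'rV[R]_n -> V :=
  foldr (fun i h => partial i h) f s.

(* C^infinity on U, meaningful when U is open. *)
Definition smooth_on (R : realType) (n : nat) (V : normedModType R)
    (U : set 'rV[R]_n) (f : 'rV[R]_n -> V) : Prop :=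
  forall (s : seq 'I_n) (x : 'rV[R]_n), U x -> differentiable (partials s f) x.

(* Supremum of the absolute values of the components of f and of their first
   and second partial derivatives. *)
Definition C2norm (R : realType) (n k : nat) (A : set 'rV[R]_n)
    (f : 'rV[R]_n -> 'M[R]_k) : \bar R :=
  ereal_sup [set y | exists (z : 'rV[R]_n) (i j : 'I_k) (s : seq 'I_n),
    [/\ A z, (size s <= 2)%N & y = (`|partials s (fun x => f x i j) z|)%:E]].

(** * Smooth manifolds *)

(* A smooth atlas indexed by the points of M: [coord p], defined on the open
   set [dom p] around p, is a chart with inverse [param p].  The tangent space
   T_p M is identified with R^n through the chart [coord p]. *)
Record manifold (R : realType) (n : nat) := Manifold {
  carrier :> topologicalType;
  dom : carrier -> set carrier;
  coord : carrier -> carrier -> 'rV[R]_n;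
  param : carrier -> 'rV[R]_n -> carrier;
  manifold_hausdorff : hausdorff_space carrier;
  manifold_second_countable : @second_countable carrier;
  dom_center : forall p, dom p p;
  dom_open : forall p, open (dom p);
  codom_open : forall p, open (coord p @` dom p);
  coordK : forall p q, dom p q -> param p (coord p q) = q;
  coord_continuous : forall p q, dom p q -> {for q, continuous (coord p)};
  param_continuous : forall p x, (coord p @` dom p) x ->
    {for x, continuous (param p)};
  transition_smooth : forall p q,
    smooth_on (coord p @` (dom p `&` dom q)) (coord q \o param p) }.

Definition smooth_from (R : realType) (k n : nat) (M : manifold R n)
    (U : set 'rV[R]_k) (F : 'rV[R]_k -> M) : Prop :=
  (forall x, U x -> {for x, continuous F}) /\
  (forall p : M, smooth_on (U `&` F @^-1` dom p) (coord p \o F)).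

Definition smooth_to (R : realType) (k n : nat) (M : manifold R n)
    (V : set M) (G : M -> 'rV[R]_k) : Prop :=
  forall p : M, smooth_on (coord p @` (V `&` dom p)) (G \o param p).

Definition diffeo (R : realType) (k n : nat) (M : manifold R n)
    (U : set 'rV[R]_k) (V : set M)
    (F : 'rV[R]_k -> M) (G : M -> 'rV[R]_k) : Prop :=
  [/\ open U, open V, F @` U = V,
      (forall x, U x -> G (F x) = x) & smooth_from U F /\ smooth_to V G].

(** * Riemannian metrics *)

(* [h p] is the matrix of a bilinear form on T_p M. *)
Definition tensor (R : realType) (n : nat) (M : manifold R n) : Type :=
  M -> 'M[R]_n.

(* Components of F^* h in the canonical basis of R^k. *)
Definition pullback (R : realType) (k n : nat) (M : manifold R n)
    (F : 'rV[R]_k -> M) (h : tensor M) (x : 'rV[R]_k) : 'M[R]_k :=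
  let dF := 'J (coord (F x) \o F) x in dF *m h (F x) *m dF^T.

(* Components of F^* h on T_p M for F : M -> M. *)
Definition pullback_self (R : realType) (n : nat) (M : manifold R n)
    (F : M -> M) (h : tensor M) : tensor M :=
  fun p => pullback (F \o param p) h (coord p p).

(* Components of df on T_p M, as a column. *)
Definition differential (R : realType) (n : nat) (M : manifold R n)
    (f : M -> R) (p : M) : 'cV[R]_n :=
  \col_i partial i (f \o param p) (coord p p).

Definition riemannian_metric (R : realType) (n : nat) (M : manifold R n)
    (g : tensor M) : Prop :=
  [/\ forall p : M, (g p)^T = g p,
      forall (p : M) (v : 'rV[R]_n), v != 0 -> 0 < (v *m g p *m v^T) 0 0
    & forall p : M, smooth_on (coord p @` dom p) (pullback (param p) g)].

Definition tangent_norm (R : realType) (n : nat) (M : manifold R n)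
    (g : tensor M) (p : M) (v : 'rV[R]_n) : R :=
  Num.sqrt ((v *m g p *m v^T) 0 0).

Definition velocity (R : realType) (n : nat) (M : manifold R n)
    (c : R -> M) (t : R) : 'rV[R]_n :=
  (coord (c t) \o c)^`()%classic t.

Definition C1_curve (R : realType) (n : nat) (M : manifold R n)
    (c : R -> M) : Prop :=
  continuous c /\
  forall (p : M) (t : R), dom p (c t) ->
    derivable (coord p \o c) t 1 /\
    {for t, continuous (coord p \o c)^`()%classic}.

Definition curve_length (R : realType) (n : nat) (M : manifold R n)
    (g : tensor M) (c : R -> M) : \bar R :=
  \int[lebesgue_measure]_(t in `[0%R, 1%R])
    (tangent_norm g (c t) (velocity c t))%:E.

Definition riemannian_dist (R : realType) (n : nat) (M : manifold R n)
    (g : tensor M) (p q : M) : \bar R :=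
  ereal_inf [set l | exists c : R -> M,
    [/\ C1_curve c, c 0 = p, c 1 = q & l = curve_length g c]].

Definition closed_gball (R : realType) (n : nat) (M : manifold R n)
    (g : tensor M) (o : M) (r : R) : set M :=
  [set p | (riemannian_dist g o p <= r%:E)%E].

(* Christoffel symbols Gamma^k_ij of g in the chart [coord p]. *)
Definition christoffel (R : realType) (n : nat) (M : manifold R n)
    (g : tensor M) (p : M) (k i j : 'I_n) (x : 'rV[R]_n) : R :=
  let G := pullback (param p) g in
  2^-1 * \sum_(l < n) (invmx (G x)) k l *
    (partial i (fun y => G y j l) x + partial j (fun y => G y i l) x
     - partial l (fun y => G y i j) x).

Definition geodesic (R : realType) (n : nat) (M : manifold R n)
    (g : tensor M) (c : R -> M) : Prop :=
  continuous c /\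
  forall (p : M) (t : R), dom p (c t) ->
    let x := coord p \o c in
    let x' := x^`()%classic in
    let x'' := x'^`()%classic in
    [/\ derivable x t 1, derivable x' t 1 &
        forall k : 'I_n,
          x'' t 0 k + \sum_(i < n) \sum_(j < n)
            christoffel g p k i j (x t) * x' t 0 i * x' t 0 j = 0].

(* Geodesic completeness. *)
Definition complete_metric (R : realType) (n : nat) (M : manifold R n)
    (g : tensor M) : Prop :=
  forall (p : M) (v : 'rV[R]_n), exists c : R -> M,
    [/\ geodesic g c, c 0 = p & velocity c 0 = v].

(* Determines E : T_o M -> M when g is complete. *)
Definition exponential_map (R : realType) (n : nat) (M : manifold R n)
    (g : tensor M) (o : M) (E : 'rV[R]_n -> M) : Prop :=
  forall c : R -> M, geodesic g c -> c 0 = o -> E (velocity c 0) = c 1.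

(* o is a center: E is the exponential map at o, and a diffeomorphism from
   T_o M onto M with inverse L. *)
Definition has_center (R : realType) (n : nat) (M : manifold R n)
    (g : tensor M) (o : M) (E : 'rV[R]_n -> M) (L : M -> 'rV[R]_n) : Prop :=
  exponential_map g o E /\ diffeo setT setT E L.

(** * Warp forcing *)

(* In what follows S^{n-1} is the unit sphere of (T_o M, g_o), and the pair
   (u, r) in S^{n-1} x R^+ stands for the point E (r *: u) of M - {o}. *)

Definition radius (R : realType) (n : nat) (M : manifold R n)
    (g : tensor M) (o : M) (L : M -> 'rV[R]_n) (p : M) : R :=
  tangent_norm g o (L p).

(* (u, r) |-> (u, r0) *)
Definition radial_proj (R : realType) (n : nat) (M : manifold R n)
    (g : tensor M) (o : M) (E : 'rV[R]_n -> M) (L : M -> 'rV[R]_n) (r0 : R)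
    (p : M) : M :=
  E ((r0 / radius g o L p) *: L p).

(* The metric g_{r0} of S^{n-1}, viewed on S^{n-1} x R^+, is the pullback of
   g = g_r + dr^2 under (u, r) |-> (u, r0). *)
Definition warped_metric (R : realType) (n : nat) (M : manifold R n)
    (g : tensor M) (o : M) (E : 'rV[R]_n -> M) (L : M -> 'rV[R]_n) (r0 : R)
    : tensor M :=
  fun p =>
    let dr := differential (radius g o L) p in
    (sinh (radius g o L p) ^+ 2 * (1 / sinh r0 ^+ 2)) *:
      pullback_self (radial_proj g o E L r0) g p
    + dr *m dr^T.

Definition cutoff (R : realType) (rho : R -> R) : Prop :=
  [/\ forall (k : nat) (t : R), derivable (rho^`(k))%classic t 1,
      forall t : R, 0 <= rho t <= 1,
      forall t : R, t <= 0 -> rho t = 0,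
      forall t : R, 1 <= t -> rho t = 1
    & (\forall t \near (0 : R), rho t = rho 0) /\
      (\forall t \near (1 : R), rho t = rho 1)].

(* Only meaningful on M - {o}. *)
Definition warp_forced (R : realType) (rho : R -> R) (n : nat)
    (M : manifold R n) (g : tensor M) (o : M)
    (E : 'rV[R]_n -> M) (L : M -> 'rV[R]_n) (r0 : R) : tensor M :=
  fun p =>
    let w := rho (2 * radius g o L p - 2 * r0) in
    (1 - w) *: warped_metric g o E L r0 p + w *: g p.

(** * Closeness to hyperbolic metrics *)

(* A point of R^n = R^{n-1} x R, n = m.+1, is (x, t) with t the last entry. *)
Definition xpart (R : realType) (m : nat) (z : 'rV[R]_m.+1) : 'rV[R]_m :=
  \row_j z 0 (lift ord_max j).

Definition tpart (R : realType) (m : nat) (z : 'rV[R]_m.+1) : R := z 0 ord_max.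

Definition unit_ball (R : realType) (m : nat) : set 'rV[R]_m :=
  [set x | \sum_(j < m) x 0 j ^+ 2 < 1].

Definition model (R : realType) (m : nat) (xi : R) : set 'rV[R]_m.+1 :=
  [set z | unit_ball (xpart z) /\ - 1 - xi < tpart z < 1 + xi].

Definition hyperbolic (R : realType) (m : nat) (z : 'rV[R]_m.+1)
    : 'M[R]_m.+1 :=
  \matrix_(i, j) if i == j then
                   if i == ord_max then 1 else expR (2 * tpart z)
                 else 0.

(* The tensor h is radially eps-close to hyperbolic on S with charts of excess
   xi; the product structure on M - {o} is that of (g, o). *)
Definition radially_close (R : realType) (m : nat) (M : manifold R m.+1)
    (g : tensor M) (o : M) (E : 'rV[R]_m.+1 -> M)
    (h : tensor M) (S : set M) (xi eps : R) : Prop :=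
  forall p : M, S p ->
    exists (phi : 'rV[R]_m.+1 -> M) (psi : M -> 'rV[R]_m.+1)
           (a : R) (phi1 : 'rV[R]_m -> 'rV[R]_m.+1),
    [/\ diffeo (model xi) (phi @` model xi) phi psi,
        phi 0 = p,
        forall x : 'rV[R]_m, unit_ball x -> tangent_norm g o (phi1 x) = 1,
        forall z : 'rV[R]_m.+1, model xi z ->
          0 < tpart z + a /\ phi z = E ((tpart z + a) *: phi1 (xpart z))
      & (C2norm (model xi) (fun z => pullback phi h z - hyperbolic z)%R
         < eps%:E)%E].

(* Main.v *)
From mathcomp Require Import all_boot all_order all_algebra.
From mathcomp Require Import all_classical all_reals all_analysis.
From mathcomp Require Import ring lra.
Require Import Defs.

Set Implicit Arguments.
Unset Strict Implicit.
Unset Printing Implicit Defensive.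

Import Order.TTheory GRing.Theory Num.Theory.
Import numFieldNormedType.Exports.

Local Open Scope classical_set_scope.
Local Open Scope ring_scope.

(** In a radial chart phi(x,t) = (phi1 x, t + a) put G = phi^* g, b = r0 - a and
    w = rho(2(t + a) - 2 r0).  The map (u,r) |-> (u,r0) becomes the slice map
    (x,t) |-> (x,b), so phi^*(W g) is
      (1 - w) [sinh^2(t+a)/sinh^2(r0) G(x,b)' + dt^2] + w G(x,t),
    where G(x,b)' keeps only the x-components; the Gauss lemma is not needed.
    A point of S outside the ball of radius r0 - 1 - xi has a > r0 - 1 - xi,
    because the geodesic from o shows that its distance to o is at most a.
    If a >= r0 + 1/2 + xi, then w = 1 on the smaller chart; otherwise b lies in
    I_xi, G(x,b) and G(x,t) are both eps-close to the hyperbolic metric, and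
    sinh^2(t+a)/sinh^2(r0) e^(2b) differs from e^(2t) by O(e^(-2 r0)) in C^2. *)

(** * Calculus on open subsets of R^n *)

Section Differentiability.
Variable R : realType.
Implicit Types V W : normedModType R.

(** The explicit constant of the theorem shapes the proof: rho enters the C^2 norm through rho, rho'
    and rho'', so a cutoff with computable bounds has to be built. Composing exp(-1/t) with itself
    gives one whose first two derivatives are at most 216 e^10; the product estimates then lead to
    the constant e^(32 + 4 xi), strictly below e^(27 + 12 xi). The unit of excess that is lost pays
    for the slice t = b. On the smaller chart |t| < xi, so the threshold a = r0 + 1/2 + xi separates
    charts lying wholly beyond radius r0 + 1/2 from charts whose enlargement contains the level r0,
    where closeness of g can be evaluated. The encoding of tensors is the other obstacle. The matrix
    [g p] refers to the chart centred at p, which moves with p, so the regularity of a pullback, or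
    of the speed of a curve, becomes visible only after rewriting in one fixed chart near the point
    considered. *)

Lemma differentiable_expansion V W (f : V -> W) (df : {linear V -> W}) (x : V) :
  continuous df -> f \o shift x = cst (f x) + df +o_ 0 id ->
  differentiable f x.
Proof.
move=> dfc dxf; have E := diff_unique dfc dxf.
by apply/diff_locallyP; rewrite E.
Qed.

Lemma near_eq_differentiable V W (f g : V -> W) (x : V) :
  (\near x, f x = g x) -> differentiable f x -> differentiable g x.
Proof.
move=> fg df; have [dfc dfE] := (diff_locallyP x f).1 df.
have fgx : f x = g x := nbhs_singleton fg.
apply: (differentiable_expansion dfc).
apply/eqaddoP => e e0.
move/eqaddoP : dfE => /(_ e e0).
move: fg; rewrite (near_shift 0) subr0 => fg.
apply: filter_app; near=> h.
rewrite /= !fctE /= -fgx; suff -> : g (h + x) = f (h + x) by [].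
by apply/esym; near: h; apply: filterS fg => h /=.
Unshelve. all: by end_near. Qed.

Lemma differentiable_mxP V m n (F : V -> 'M[R]_(m, n)) (x : V) :
  differentiable F x <-> forall i j, differentiable (fun y => F y i j) x.
Proof.
split=> [dF i j|dF].
  apply: (@differentiable_comp _ _ _ _ F (fun N : 'M[R]_(m, n) => N i j)) => //.
  exact: differentiable_coord.
have -> : F = \sum_(i < m) \sum_(j < n) (fun y => F y i j *: delta_mx i j).
  apply/funext => y; rewrite {1}[F y]matrix_sum_delta fct_sumE.
  by apply: eq_bigr => i _; rewrite fct_sumE.
apply: differentiable_sum => i; apply: differentiable_sum => j.
exact: differentiableZl.
Qed.

Lemma derive_entry V m n (F : V -> 'M[R]_(m, n)) (x v : V) i j :
  differentiable F x -> 'D_v F x i j = 'D_v (fun y => F y i j) x.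
Proof. by move=> dF; rewrite derive_mx ?mxE//; exact: diff_derivable. Qed.

Lemma jacobian_entry n m (F : 'rV[R]_n -> 'rV[R]_m) x i j :
  differentiable F x -> 'J F x i j = partial i (fun y => F y 0 j) x.
Proof.
move=> dF; rewrite /partial -derive_entry// deriveEjacobian//.
by rewrite /basis_vec -rowE [RHS]mxE.
Qed.

Lemma jacobian_comp k n m (G : 'rV[R]_k -> 'rV[R]_n) (F : 'rV[R]_n -> 'rV[R]_m) x :
  differentiable G x -> differentiable F (G x) ->
  'J (F \o G) x = 'J G x *m 'J F (G x).
Proof.
move=> dG dF; apply/row_matrixP => i.
rewrite row_mul !rowE -!deriveEjacobian //; last exact: differentiable_comp.
rewrite !deriveE //; last exact: differentiable_comp.
by rewrite diff_comp.
Qed.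

Lemma partial_comp k n (G : 'rV[R]_k -> 'rV[R]_n) (f : 'rV[R]_n -> R) x i :
  differentiable G x -> differentiable f (G x) ->
  partial i (f \o G) x =
    \sum_j partial i (fun y => G y 0 j) x * partial j f (G x).
Proof.
move=> dG df; rewrite /partial deriveE; last exact: differentiable_comp.
rewrite diff_comp //= -(@deriveE _ _ _ G x _ dG) (row_sum_delta ('D__ G x)).
rewrite linear_sum; apply: eq_bigr => j _.
by rewrite linearZ/= derive_entry// -deriveE.
Qed.

Lemma near_eq_jacobian n m (F G : 'rV[R]_n -> 'rV[R]_m) x :
  (\near x, F x = G x) -> differentiable F x -> 'J F x = 'J G x.
Proof.
move=> FG dF; have dG := near_eq_differentiable FG dF.
apply/matrixP => i j; rewrite [LHS](jacobian_entry i j dF) [RHS](jacobian_entry i j dG).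
by apply: near_eq_derive; apply: filterS FG => y ->.
Qed.

Lemma jacobian_id n (x : 'rV[R]_n) : 'J id x = 1%:M.
Proof.
apply/row_matrixP => i; rewrite rowE -deriveEjacobian; last exact: ex_diff.
by rewrite derive_id rowE mulmx1.
Qed.

End Differentiability.

(** * Differentiability of finite order *)

Section Ck.
Variable R : realType.

(* The index is shifted by one: [ck k U f] requires the partial derivatives of
   order at most k, f included, to be differentiable on U. *)
Fixpoint ck (k n : nat) (U : set 'rV[R]_n) (f : 'rV[R]_n -> R) : Prop :=
  (forall x, U x -> differentiable f x) /\
  (if k is k'.+1 then forall i, ck k' U (partial i f) else True).

Section Dim.
Variables (n : nat) (U : set 'rV[R]_n).
Hypothesis Uo : open U.
Implicit Types f g : 'rV[R]_n -> R.

Lemma ck_diff k f x : ck k U f -> U x -> differentiable f x.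
Proof. by case: k => [|k] [+ _] => /[apply]. Qed.

Lemma ckSP k f : ck k.+1 U f -> forall i, ck k U (partial i f).
Proof. by case. Qed.

Lemma ckW k f : ck k.+1 U f -> ck k U f.
Proof. by elim: k f => [|k IH] f [df d2f]; split=> // i; exact: IH (d2f i). Qed.

Lemma ck_subset k (V : set 'rV[R]_n) f : V `<=` U -> ck k U f -> ck k V f.
Proof.
move=> VU; elim: k f => [|k IH] f [df d2f]; split=> //.
- by move=> x /VU/df.
- by move=> x /VU/df.
- by move=> i; exact: IH (d2f i).
Qed.

Lemma near_open f g x : {in U, f =1 g} -> U x -> \near x, f x = g x.
Proof.
move=> fg Ux; near=> y; apply: fg; rewrite inE; near: y.
exact: open_nbhs_nbhs.
Unshelve. all: by end_near. Qed.

Lemma partial_ext f g i : {in U, f =1 g} -> {in U, partial i f =1 partial i g}.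
Proof.
by move=> fg x; rewrite inE => Ux; apply: near_eq_derive; exact: near_open.
Qed.

Lemma partials_ext f g s :
  {in U, f =1 g} -> {in U, partials s f =1 partials s g}.
Proof. by move=> fg; elim: s => [|i s IH] //=; exact: partial_ext. Qed.

Lemma ck_ext k f g : {in U, f =1 g} -> ck k U f -> ck k U g.
Proof.
elim: k f g => [|k IH] f g fg [df d2f]; split=> //.
- by move=> x Ux; apply: near_eq_differentiable (df x Ux); exact: near_open.
- by move=> x Ux; apply: near_eq_differentiable (df x Ux); exact: near_open.
- by move=> i; apply: IH (d2f i); exact: partial_ext.
Qed.

Lemma ck_cst k (c : R) : ck k U (cst c).
Proof.
elim: k c => [|k IH] c; split=> // i; apply: (ck_ext _ (IH 0)) => x _.
by rewrite /partial derive_cst.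
Qed.

Lemma ck_add k f g : ck k U f -> ck k U g -> ck k U (f \+ g).
Proof.
elim: k f g => [|k IH] f g [df d2f] [dg d2g]; split=> //.
- by move=> x Ux; apply: differentiableD; [exact: df|exact: dg].
- by move=> x Ux; apply: differentiableD; [exact: df|exact: dg].
- move=> i; apply: (ck_ext _ (IH _ _ (d2f i) (d2g i))) => x; rewrite inE => Ux.
  by rewrite /partial deriveD //; apply: diff_derivable; [exact: df|exact: dg].
Qed.

Lemma ck_mul k f g : ck k U f -> ck k U g -> ck k U (f \* g).
Proof.
elim: k f g => [|k IH] f g cf cg; have [df d2f] := cf; have [dg d2g] := cg; split=> //.
- by move=> x Ux; apply: differentiableM; [exact: df|exact: dg].
- by move=> x Ux; apply: differentiableM; [exact: df|exact: dg].
- move=> i; apply: (@ck_ext _ ((f \* partial i g) \+ (g \* partial i f))); last first.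
    apply: ck_add; first exact: IH (ckW cf) (d2g i).
    exact: IH (ckW cg) (d2f i).
  move=> x; rewrite inE => Ux.
  by rewrite /partial deriveM //; apply: diff_derivable; [exact: df|exact: dg].
Qed.

Lemma ck_sum k (I : Type) (r : seq I) (F : I -> 'rV[R]_n -> R) :
  (forall j, ck k U (F j)) -> ck k U (fun x => \sum_(j <- r) F j x).
Proof.
move=> cF; elim: r => [|j r IH].
  by apply: ck_ext (ck_cst k 0) => x _; rewrite big_nil.
by apply: ck_ext (ck_add (cF j) IH) => x _; rewrite big_cons.
Qed.

Lemma smooth_on_entry k m l (F : 'rV[R]_n -> 'M[R]_(m, l)) a b :
  smooth_on U F -> ck k U (fun x => F x a b).
Proof.
elim: k F => [|k IH] F sF; split=> //.
- by move=> x Ux; apply: (differentiable_mxP _ _).1; exact: (sF [::]).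
- by move=> x Ux; apply: (differentiable_mxP _ _).1; exact: (sF [::]).
(* The last entry of the list is the innermost derivative, so prefixing F by [partial i] appends i
   to the list. *)
- move=> i; have sFi : smooth_on U (partial i F).
    by move=> s; have := sF (rcons s i); rewrite /partials foldr_rcons.
  apply: ck_ext (IH _ sFi) => x; rewrite inE => Ux.
  by rewrite /partial derive_entry//; exact: (sF [::]).
Qed.

End Dim.

(** By induction on the order: the chain rule writes a partial derivative of the composite as a sum
    of products of terms to which the previous order applies. *)
Lemma ck_comp K k n (U : set 'rV[R]_k) (V : set 'rV[R]_n)
    (G : 'rV[R]_k -> 'rV[R]_n) (f : 'rV[R]_n -> R) :
  open U -> (forall j, ck K U (fun x => G x 0 j)) -> ck K V f ->
  G @` U `<=` V -> ck K U (f \o G).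
Proof.
move=> Uo cG cf GUV.
have dG x : U x -> differentiable G x.
  move=> Ux; apply/differentiable_mxP => i j; rewrite (ord1 i).
  exact: ck_diff (cG j) Ux.
have UV x : U x -> V (G x) by move=> Ux; apply: GUV; exists x.
elim: K f cG cf => [|K IH] f cG cf; split=> //.
- by move=> x Ux; apply: differentiable_comp (dG _ Ux) _; exact: ck_diff cf (UV _ Ux).
- by move=> x Ux; apply: differentiable_comp (dG _ Ux) _; exact: ck_diff cf (UV _ Ux).
- move=> i; apply: (@ck_ext _ _ Uo _ (fun x =>
      \sum_j partial i (fun y => G y 0 j) x * (partial j f \o G) x)).
    move=> x; rewrite inE => Ux; rewrite partial_comp //; first exact: dG.
    exact: ck_diff cf (UV _ Ux).
  apply: (ck_sum Uo) => j; apply: (ck_mul Uo); first exact: (ckSP (cG j)).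
  by apply: IH => [l|]; [exact: ckW|exact: (ckSP cf)].
Qed.

End Ck.

(** * Pullbacks of tensors *)

(** All conditions in [ck] are pointwise, so they glue over any cover. This allows every point to
    use the chart centred at its own image. *)
Lemma ck_local (R : realType) k n (U : set 'rV[R]_n) (f : 'rV[R]_n -> R) :
  (forall x, U x -> exists2 V : set 'rV[R]_n, V x & ck k V f) -> ck k U f.
Proof.
elim: k f => [|k IH] f lf; split=> //.
- by move=> x /lf [V Vx /ck_diff]; exact.
- by move=> x /lf [V Vx /ck_diff]; exact.
- move=> i; apply: IH => x /lf [V Vx cf]; exists V => //; exact: ckSP cf i.
Qed.

Lemma congruence_entry (R : comPzRingType) k n (A : 'M[R]_(k, n)) (B : 'M[R]_n) i j :
  (A *m B *m A^T) i j = \sum_l (\sum_m A i m * B m l) * A j l.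
Proof. by rewrite mxE; apply: eq_bigr => l _; rewrite !mxE. Qed.

Section Pullback.
Variables (R : realType) (n : nat) (M : manifold R n).
Implicit Types (h : tensor M) (p q : M).

Lemma pullbackD k (F : 'rV[R]_k -> M) (h h' : tensor M) x :
  pullback F (fun p => h p + h' p) x = pullback F h x + pullback F h' x.
Proof. by rewrite /pullback mulmxDr mulmxDl. Qed.

Lemma pullbackZ k (F : 'rV[R]_k -> M) (c : M -> R) h x :
  pullback F (fun p => c p *: h p) x = c (F x) *: pullback F h x.
Proof. by rewrite /pullback -scalemxAr -scalemxAl. Qed.

Lemma near_eq_pullback k (F G : 'rV[R]_k -> M) h x :
  (\near x, F x = G x) -> differentiable (coord (F x) \o F) x ->
  pullback F h x = pullback G h x.
Proof.
move=> FG dF; rewrite /pullback -(nbhs_singleton FG).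
suff -> : 'J (coord (F x) \o G) x = 'J (coord (F x) \o F) x by [].
apply/esym/near_eq_jacobian => //.
by apply: filterS FG => y /= ->.
Qed.

Lemma pullback_comp k l (F : 'rV[R]_k -> M) (P : 'rV[R]_l -> 'rV[R]_k) h x :
  differentiable P x -> differentiable (coord (F (P x)) \o F) (P x) ->
  pullback (F \o P) h x = 'J P x *m pullback F h (P x) *m ('J P x)^T.
Proof.
move=> dP dF; rewrite /pullback -[coord _ \o (F \o P)]/((coord (F (P x)) \o F) \o P).
by rewrite (jacobian_comp dP dF) trmx_mul !mulmxA.
Qed.

Lemma open_chart_preimage k (U : set 'rV[R]_k) (F : 'rV[R]_k -> M) p :
  open U -> (forall x, U x -> {for x, continuous F}) ->
  open (U `&` F @^-1` dom p).
Proof.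
move=> Uo cF; rewrite openE => x [Ux Dx].
apply: filterI; first exact: open_nbhs_nbhs.
by apply: (cF x Ux); apply: open_nbhs_nbhs; split=> //; exact: dom_open.
Qed.

Lemma differentiable_chart k (U : set 'rV[R]_k) (F : 'rV[R]_k -> M) p x :
  smooth_from U F -> U x -> dom p (F x) -> differentiable (coord p \o F) x.
Proof. by move=> [_ /(_ p [::] x)] /= H Ux Dx; exact: H. Qed.

Lemma differentiable_transition p q :
  dom p q -> differentiable (coord q \o param p) (coord p q).
Proof.
move=> pq; apply: (@transition_smooth _ _ M p q [::]).
by exists q => //; split=> //; exact: dom_center.
Qed.

Lemma chart_near k (F : 'rV[R]_k -> M) p x :
  {for x, continuous F} -> dom p (F x) -> \near x, F x = param p (coord p (F x)).
Proof.
move=> cF Dx; have : \near x, dom p (F x).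
  by apply: cF; apply: open_nbhs_nbhs; split=> //; exact: dom_open.
by apply: filterS => y Dy; rewrite coordK.
Qed.

(** The defining formula of [pullback] uses the chart [coord (F x)], which varies with x; here the
    chart p is fixed, so the right-hand side can be differentiated in x. *)
Lemma pullback_chart k (F : 'rV[R]_k -> M) h p x :
  {for x, continuous F} -> dom p (F x) -> differentiable (coord p \o F) x ->
  pullback F h x =
    'J (coord p \o F) x *m pullback (param p) h (coord p (F x))
    *m ('J (coord p \o F) x)^T.
Proof.
move=> cF Dx dF; apply: (etrans _ (pullback_comp h dF _)); last first.
  by rewrite /= coordK //; exact: differentiable_transition.
apply/esym/near_eq_pullback; first by apply: filterS (chart_near cF Dx) => y /= <-.
rewrite /= coordK //.
rewrite -[_ \o _]/((coord (F x) \o param p) \o (coord p \o F)).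
apply: differentiable_comp => //.
exact: differentiable_transition.
Qed.

Lemma ck_pullback k (U : set 'rV[R]_k) (F : 'rV[R]_k -> M) h i j K :
  (forall p, smooth_on (coord p @` dom p) (pullback (param p) h)) ->
  open U -> smooth_from U F -> ck K U (fun x => pullback F h x i j).
Proof.
move=> sh Uo sF; apply: ck_local => x Ux.
pose p := F x; pose V := U `&` F @^-1` dom p.
have Vo : open V by apply: open_chart_preimage => //; exact: sF.1.
exists V; first by split=> //; exact: dom_center.
have cF K' l : ck K' V (fun y => (coord p \o F) y 0 l).
  by apply: smooth_on_entry => //; exact: sF.2.
(* A Jacobian entry costs one derivative, whence the order [K.+1] for the components of F. *)
have cJ a l : ck K V (fun y => 'J (coord p \o F) y a l).
  apply: (ck_ext Vo) (ckSP (cF K.+1 l) a) => y; rewrite inE => -[Uy Dy].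
  by rewrite jacobian_entry//; exact: differentiable_chart sF Uy Dy.
have cG a b : ck K V (fun y => pullback (param p) h ((coord p \o F) y) a b).
  apply: (@ck_comp _ _ _ _ V (coord p @` dom p) (coord p \o F)
    (fun z => pullback (param p) h z a b)) => //.
    by apply: smooth_on_entry; [exact: codom_open|exact: sh].
  by move=> _ [y [Uy Dy] <-]; exists (F y).
apply: (@ck_ext _ _ _ Vo _ (fun y => \sum_l (\sum_m
    'J (coord p \o F) y i m * pullback (param p) h ((coord p \o F) y) m l)
    * 'J (coord p \o F) y j l)).
  move=> y; rewrite inE => -[Uy Dy]; rewrite [pullback F h y](@pullback_chart _ _ _ p)//.
  - by apply: esym; exact: congruence_entry.
  - exact: sF.1.
  - exact: differentiable_chart sF Uy Dy.
apply: (ck_sum Vo) => l; apply: (ck_mul Vo) => //.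
by apply: (ck_sum Vo) => m; exact: (ck_mul Vo).
Qed.

(** [pullback_self P h] at q is the pullback along [P \o param q]. Composing with [coord q \o F]
    gives P o F near x, and the chain rule concludes. *)
Lemma pullback_pullback_self k (F : 'rV[R]_k -> M) (P : M -> M) h x :
  {for x, continuous F} ->
  differentiable (coord (F x) \o F) x ->
  differentiable (coord (P (F x)) \o P \o param (F x)) (coord (F x) (F x)) ->
  pullback F (pullback_self P h) x = pullback (P \o F) h x.
Proof.
move=> cF dF dP; pose q := F x.
have qq : param q (coord q q) = q by rewrite coordK//; exact: dom_center.
rewrite [LHS]/pullback /pullback_self.
transitivity (pullback ((P \o param q) \o (coord q \o F)) h x).
  rewrite pullback_comp //= coordK//; exact: dom_center.
apply: near_eq_pullback.
  by apply: filterS (chart_near cF (dom_center (F x))) => y /= <-.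
rewrite /= coordK; last exact: dom_center.
rewrite -[_ \o _]/((coord (P q) \o P \o param q) \o (coord q \o F)).
exact: differentiable_comp.
Qed.

Lemma pullback_differential k (F : 'rV[R]_k -> M) (f : M -> R) x :
  {for x, continuous F} ->
  differentiable (coord (F x) \o F) x ->
  differentiable (f \o param (F x)) (coord (F x) (F x)) ->
  pullback F (fun p => differential f p *m (differential f p)^T) x =
    \matrix_(i, j) (partial i (f \o F) x * partial j (f \o F) x).
Proof.
move=> cF dF df; pose q := F x.
have E : 'J (coord q \o F) x *m differential f q = \col_i partial i (f \o F) x.
  apply/colP => i; rewrite [LHS]mxE [RHS]mxE.
  transitivity (partial i ((f \o param q) \o (coord q \o F)) x).
    rewrite (@partial_comp _ _ _ (coord q \o F)) //; apply: eq_bigr => l _.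
    by rewrite jacobian_entry// [X in _ * X]mxE.
  apply: near_eq_derive.
  by apply: filterS (chart_near cF (dom_center (F x))) => y /= <-.
rewrite /pullback mulmxA -mulmxA -trmx_mul E; apply/matrixP => i j.
by rewrite !mxE big_ord1 !mxE.
Qed.

End Pullback.

(** * Distance along geodesics *)

(** [D i j k] stands for the derivative of [G j k] in direction i, v for the velocity and w for the
    acceleration; the conclusion says that the squared speed has derivative zero. Lowering the index
    of the geodesic equation turns each of the two acceleration terms into -T/2, which cancels the
    term T coming from the derivative of the metric. *)
Lemma geodesic_energy_identity (F : numFieldType) n (G : 'M[F]_n)
    (D : 'I_n -> 'I_n -> 'I_n -> F) (v w : 'rV[F]_n) :
  G^T = G -> G \in unitmx ->
  (forall k, w 0 k + \sum_i \sum_j (2^-1 * \sum_l invmx G k l *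
      (D i j l + D j i l - D l i j)) * v 0 i * v 0 j = 0) ->
  \sum_i \sum_j (w 0 i * G i j * v 0 j + v 0 i * G i j * w 0 j
    + v 0 i * (\sum_k v 0 k * D k i j) * v 0 j) = 0.
Proof.
move=> Gs Gu hw.
pose A : 'cV[F]_n := \col_l \sum_i \sum_j
  (D i j l + D j i l - D l i j) * v 0 i * v 0 j.
have wE : w^T = - 2^-1 *: (invmx G *m A).
  apply/colP => k; have /eqP := hw k; rewrite addr_eq0 => /eqP E.
  rewrite mxE E !mxE mulNr mulr_sumr; congr (- _).
  under [RHS]eq_bigr => l _ do rewrite mxE mulr_sumr mulr_sumr.
  rewrite [RHS]exchange_big /=; apply: eq_bigr => i _.
  under [RHS]eq_bigr => l _ do rewrite mulr_sumr mulr_sumr.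
  rewrite [RHS]exchange_big /=; apply: eq_bigr => j _.
  rewrite mulr_sumr !mulr_suml; apply: eq_bigr => l _; ring.
have GwE : G *m w^T = - 2^-1 *: A.
  by rewrite wE -scalemxAr mulmxA mulmxV// mul1mx.
have rot (f : 'I_n -> 'I_n -> 'I_n -> F) :
    \sum_i \sum_j \sum_k f i j k = \sum_i \sum_j \sum_k f k i j.
  by rewrite exchange_big /=; apply: eq_bigr => j _; rewrite exchange_big.
have swp (f : 'I_n -> 'I_n -> 'I_n -> F) :
    \sum_i \sum_j \sum_k f i j k = \sum_i \sum_j \sum_k f i k j.
  by apply: eq_bigr => j _; rewrite exchange_big.
(* T contracts D with v in all three slots. After renaming indices, the three Christoffel terms
   contribute T, T and -T. *)
pose T := \sum_i \sum_j \sum_k D i j k * v 0 i * v 0 j * v 0 k.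
have vA : \sum_l v 0 l * A l 0 = T.
  transitivity (\sum_l \sum_i \sum_j (D i j l * v 0 i * v 0 j * v 0 l
      + (D j i l * v 0 j * v 0 i * v 0 l - D l i j * v 0 l * v 0 i * v 0 j))).
    apply: eq_bigr => l _; rewrite mxE mulr_sumr; apply: eq_bigr => i _.
    by rewrite mulr_sumr; apply: eq_bigr => j _; ring.
  under eq_bigr => l _ do under eq_bigr => i _ do rewrite big_split sumrB.
  under eq_bigr => l _ do rewrite big_split sumrB.
  rewrite big_split sumrB /=.
  have -> : \sum_l \sum_i \sum_j D i j l * v 0 i * v 0 j * v 0 l = T.
    by rewrite /T [RHS]rot [RHS]rot.
  have -> : \sum_l \sum_i \sum_j D j i l * v 0 j * v 0 i * v 0 l = T.
    by rewrite /T [RHS]swp [RHS]rot.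
  by rewrite subrr addr0.
have vGw : \sum_i \sum_j v 0 i * G i j * w 0 j = - 2^-1 * T.
  rewrite -vA mulr_sumr; apply: eq_bigr => i _.
  transitivity (v 0 i * (G *m w^T) i 0).
    by rewrite mxE mulr_sumr; apply: eq_bigr => j _; rewrite mxE mulrA.
  by rewrite GwE mxE mulrCA.
under eq_bigr do rewrite !big_split /=.
rewrite !big_split /=.
have -> : \sum_i \sum_j w 0 i * G i j * v 0 j = - 2^-1 * T.
  rewrite -vGw exchange_big /=; apply: eq_bigr => i _; apply: eq_bigr => j _.
  by rewrite -{1}Gs mxE; ring.
rewrite vGw.
have -> : \sum_i \sum_j v 0 i * (\sum_k v 0 k * D k i j) * v 0 j = T.
  rewrite /T [RHS]rot; apply: eq_bigr => i _; apply: eq_bigr => j _.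
  by rewrite mulr_sumr mulr_suml; apply: eq_bigr => k _; ring.
by field.
Qed.

Section Curves.
Variable R : realType.

Lemma derive1_entry n (x : R -> 'rV[R]_n) t i :
  derivable x t 1 ->
  is_derive t (1 : R) (fun s => x s 0 i) (x^`()%classic t 0 i).
Proof.
move=> dx; apply: DeriveDef; first exact: (derivable_mxP x t 1).1.
by rewrite derive1E derive_entry//; exact/derivable1_diffP.
Qed.

Lemma is_derive_comp_curve n (x : R -> 'rV[R]_n) (f : 'rV[R]_n -> R) t :
  derivable x t 1 -> differentiable f (x t) ->
  is_derive t (1 : R) (f \o x)
    (\sum_k x^`()%classic t 0 k * partial k f (x t)).
Proof.
move=> /derivable1_diffP dx df; apply: DeriveDef.
  by apply: diff_derivable; exact: differentiable_comp.
rewrite (deriveE _ (differentiable_comp dx df)).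
rewrite diff_comp//= -(derive1E' dx) {1}(row_sum_delta (x^`()%classic t)).
rewrite linear_sum; apply: eq_bigr => k _.
by rewrite linearZ/= -deriveE.
Qed.

Lemma derive1_comp_map n m (x : R -> 'rV[R]_n) (F : 'rV[R]_n -> 'rV[R]_m) t :
  derivable x t 1 -> differentiable F (x t) ->
  (F \o x)^`()%classic t = x^`()%classic t *m 'J F (x t).
Proof.
move=> dx dF; apply/rowP => j.
have dFx : derivable (F \o x) t 1.
  by apply/derivable1_diffP/differentiable_comp => //; exact/derivable1_diffP.
have dFj := (differentiable_mxP F (x t)).1 dF 0 j.
rewrite -[LHS](@derive_val _ _ _ _ _ _ _ (derive1_entry j dFx)).
rewrite [LHS](@derive_val _ _ _ _ _ _ _ (is_derive_comp_curve dx dFj)).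
by rewrite [RHS]mxE; apply: eq_bigr => k _; rewrite jacobian_entry.
Qed.

End Curves.

Section Geodesics.
Variables (R : realType) (n : nat) (M : manifold R n) (g : tensor M).
Hypothesis gR : riemannian_metric g.

Lemma pullback_param_center p : pullback (param p) g (coord p p) = g p.
Proof.
have pp : dom p p := dom_center p.
rewrite /pullback coordK //.
suff -> : 'J (coord p \o param p) (coord p p) = 1%:M.
  by rewrite mul1mx trmx1 mulmx1.
rewrite -(jacobian_id (coord p p)); apply: near_eq_jacobian; last first.
  exact: differentiable_transition.
have : \forall y \near coord p p, (coord p @` dom p) y.
  by apply: open_nbhs_nbhs; split; [exact: codom_open|exists p].
by apply: filterS => _ [q pq <-] /=; rewrite coordK.
Qed.

Lemma metric_unit p : g p \in unitmx.
Proof.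
have [_ gpos _] := gR.
rewrite -row_free_unit -kermx_eq0; apply/rowV0P => v /sub_kermxP vg0.
apply/eqP; apply: contraT => /(gpos p); by rewrite vg0 mul0mx mxE ltxx.
Qed.

Lemma pullback_sym k (F : 'rV[R]_k -> M) x :
  (pullback F g x)^T = pullback F g x.
Proof.
by have [gs _ _] := gR; rewrite /pullback !trmx_mul trmxK gs mulmxA.
Qed.

Definition energy (c : R -> M) (t : R) : R :=
  (velocity c t *m g (c t) *m (velocity c t)^T) 0 0.

(** [velocity] is read in the chart centred at [c t], which changes with t; a fixed chart p is
    required before differentiating in time. *)
Lemma energy_chart (c : R -> M) p t :
  {for t, continuous c} -> dom p (c t) -> derivable (coord p \o c) t 1 ->
  energy c t = ((coord p \o c)^`()%classic t *m pullback (param p) g (coord p (c t))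
    *m ((coord p \o c)^`()%classic t)^T) 0 0.
Proof.
move=> cc pct dx; rewrite /energy.
have -> : velocity c t = (coord p \o c)^`()%classic t *m
    'J (coord (c t) \o param p) (coord p (c t)).
  apply: (etrans _ (derive1_comp_map dx (differentiable_transition pct))).
  rewrite /velocity !derive1E; apply: near_eq_derive.
  have : \near t, dom p (c t).
    by apply: cc; apply: open_nbhs_nbhs; split=> //; exact: dom_open.
  by apply: filterS => s ps /=; rewrite coordK.
rewrite /pullback coordK// trmx_mul !mulmxA//.
Qed.

(** The fixed chart is the one centred at [c t]: there the matrix of the metric is [g p] itself,
    hence invertible, as the algebraic identity requires. *)
Lemma is_derive_energy (c : R -> M) t :
  geodesic g c -> is_derive t (1 : R) (energy c) 0.
Proof.
move=> [cc hc]; pose p := c t; pose x := coord p \o c.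
pose G := pullback (param p) g.
have pct : dom p (c t) := dom_center (c t).
have [dx ddx geo] := hc p t pct.
have near_dom : \near t, dom p (c t).
  by apply: cc; apply: open_nbhs_nbhs; split=> //; exact: dom_open.
pose Q := \sum_i \sum_j ((fun s => x^`()%classic s 0 i) * (fun s => G (x s) i j)
   * (fun s => x^`()%classic s 0 j)).
have EQ : \near t, Q t = energy c t.
  apply: filterS near_dom => s ps; have [dxs _ _] := hc p s ps.
  rewrite (energy_chart (cc s) ps dxs) congruence_entry /Q fct_sumE.
  under eq_bigr => i _ do rewrite fct_sumE.
  rewrite exchange_big /=; apply: eq_bigr => j _; rewrite mulr_suml.
  exact: eq_bigr.
apply: (near_eq_is_derive EQ).
have dG i j : differentiable (fun y => G y i j) (x t).
  have [_ _ sg] := gR.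
  have cG : ck 0 (coord p @` dom p) (fun y => G y i j).
    by apply: smooth_on_entry; [exact: codom_open|exact: sg].
  by apply: ck_diff cG _; exists (c t).
have Dx i := derive1_entry i ddx.
have DG i j := is_derive_comp_curve dx (dG i j).
have H i j := is_deriveM (is_deriveM (Dx i) (DG i j)) (Dx j).
have DQ := is_derive_sum (fun i => is_derive_sum (fun j => H i j)).
apply: is_derive_eq DQ _.
have Gp : G (x t) = g p := pullback_param_center p.
have Gs : (G (x t))^T = G (x t) by exact: pullback_sym.
have Gu : G (x t) \in unitmx by rewrite Gp metric_unit.
rewrite -[RHS](geodesic_energy_identity Gs Gu geo).
apply: eq_bigr => i _; apply: eq_bigr => j _.
rewrite !fctE /GRing.scale /=.
ring.
Qed.

(** The geodesic itself competes in the infimum. Its energy is constant, so its length over [0, 1]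
    is its initial speed. *)
Lemma riemannian_dist_exponential (o : M) (E : 'rV[R]_n -> M) v :
  complete_metric g -> exponential_map g o E ->
  (riemannian_dist g o (E v) <= (tangent_norm g o v)%:E)%E.
Proof.
move=> gC expE; have [c [gc c0 vc]] := gC o v.
have Ev : E v = c 1 by rewrite -vc expE.
apply: ereal_inf_lbound; exists c; split=> //.
  split=> [|p t pct]; first exact: gc.1.
  have [dx ddx _] := gc.2 p t pct; split; first exact: dx.
  exact: differentiable_continuous ((derivable1_diffP _ _).1 ddx).
have speed t : tangent_norm g (c t) (velocity c t) = tangent_norm g o v.
  rewrite /tangent_norm -/(energy c t).
  rewrite (is_derive_0_is_cst t 0 (fun s => is_derive_energy s gc)).
  by rewrite /energy vc c0.
rewrite /curve_length.
under eq_integral => t _ do rewrite speed.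
rewrite integral_cst// -[LHS]mule1; congr (_ * _)%E; apply: esym.
have := lebesgue_measure_itv `[0%R : R, 1%R]; rewrite /= lte_fin ltr01 sube0.
exact.
Qed.

End Geodesics.

(** * The cutoff function *)

Section Cutoff.
Variable R : realType.
Implicit Types f g : R -> R.

Lemma derive1_is_derive f (df : R -> R) :
  (forall t, is_derive t (1 : R) f (df t)) -> f^`()%classic = df.
Proof. by move=> H; apply/funext => t; rewrite derive1E derive_val. Qed.

(* Same indexing as [ck]. *)
Fixpoint ck1 (k : nat) f : Prop :=
  (forall t, derivable f t 1) /\
  (if k is k'.+1 then ck1 k' f^`()%classic else True).

Lemma ck1_derivable k f t : ck1 k f -> derivable f t 1.
Proof. by case: k => [|k] [+ _]. Qed.

Lemma ck1W k f : ck1 k.+1 f -> ck1 k f.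
Proof. by elim: k f => [|k IH] f [df d2f]; split=> //; exact: IH. Qed.

Lemma ck1_derive1n f k t : (forall K, ck1 K f) -> derivable (f^`(k))%classic t 1.
Proof.
elim: k f => [|k IH] f cf; first exact: ck1_derivable (cf 0%N).
by rewrite derive1Sn; apply: IH => K; case: (cf K.+1).
Qed.

Lemma ck1_cst k (c : R) : ck1 k (cst c).
Proof.
elim: k c => [|k IH] c; split=> //.
by rewrite (_ : _^`()%classic = cst 0)//; apply/funext => t; rewrite derive1_cst.
Qed.

Lemma ck1_add k f g : ck1 k f -> ck1 k g -> ck1 k (f + g).
Proof.
elim: k f g => [|k IH] f g [df d2f] [dg d2g].
  by split=> [t|]; [exact: derivableD|exact: I].
split=> [t|]; first exact: derivableD.
rewrite (_ : (f + g)^`()%classic = f^`()%classic + g^`()%classic); first exact: IH.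
apply/funext => t; rewrite derive1E (deriveD (df t) (dg t)).
by rewrite fctE !derive1E.
Qed.

Lemma ck1_mul k f g : ck1 k f -> ck1 k g -> ck1 k (f * g).
Proof.
elim: k f g => [|k IH] f g cf cg; have [df d2f] := cf; have [dg d2g] := cg.
  by split=> [t|]; [exact: derivableM|exact: I].
split=> [t|]; first exact: derivableM.
rewrite (_ : (f * g)^`()%classic = f * g^`()%classic + g * f^`()%classic).
  apply: ck1_add; first exact: IH (ck1W cf) d2g.
  exact: IH (ck1W cg) d2f.
apply/funext => t; rewrite derive1E (deriveM (df t) (dg t)).
by rewrite !fctE !derive1E.
Qed.

Lemma ck1_comp k f g : ck1 k f -> ck1 k g -> ck1 k (f \o g).
Proof.
have dcomp (u v : R -> R) t : derivable u (v t) 1 -> derivable v t 1 ->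
    derivable (u \o v) t 1.
  move=> /derivable1_diffP du /derivable1_diffP dv.
  by apply/derivable1_diffP; exact: differentiable_comp.
elim: k f => [|k IH] f cf cg; have [df d2f] := cf; have [dg d2g] := cg.
  by split=> [t|]; [exact: dcomp|exact: I].
split=> [t|]; first exact: dcomp.
rewrite (_ : (f \o g)^`()%classic = (f^`()%classic \o g) * g^`()%classic).
  by apply: ck1_mul => //; apply: IH => //; exact: ck1W.
by apply/funext => t; rewrite derive1_comp.
Qed.

(* For k = 0 this is exp(-1/t); the family is closed under differentiation. *)
Definition flat (k : nat) (t : R) : R :=
  if 0 < t then t^-1 ^+ k * expR (- t^-1) else 0.

Lemma flat_ge0 k t : 0 <= flat k t.
Proof.
rewrite /flat; case: ifPn => // t0.
by rewrite mulr_ge0 ?expR_ge0// exprn_ge0// invr_ge0 ltW.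
Qed.

(** With u = 1/t this is u^k e^(-u) <= k!, a single term of the exponential series. *)
Lemma flat_le k t : flat k t <= k`!%:R.
Proof.
rewrite /flat; case: ifPn => // t0.
have u0 : 0 < t^-1 by rewrite invr_gt0.
rewrite expRN -ler_pdivlMr ?invr_gt0 ?expR_gt0// invrK.
case: k => [|k]; first by rewrite expr0 mul1r -{1}expR0 ler_expR ltW.
rewrite -ler_pdivrMl ?ltr0n ?fact_gt0//.
apply: le_trans (expR_ge1Dxn k (ltW u0)).
by rewrite mulrC lerDr.
Qed.

Lemma flat_le_sq k t : 0 <= t -> flat k t <= (k.+2)`!%:R * t ^+ 2.
Proof.
rewrite le0r => /orP[/eqP ->|t0]; first by rewrite /flat ltxx expr0n mulr0.
rewrite -ler_pdivrMr ?exprn_gt0//; apply: le_trans (flat_le k.+2 t).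
by rewrite /flat t0 mulrAC -exprVn -exprD addn2.
Qed.

(** This handles the junction t = 0 of [flat], where the definition by cases offers no formula to
    differentiate. *)
Lemma is_derive_quadratic f (C : R) : 0 <= C ->
  (forall t, `|f t| <= C * t ^+ 2) -> is_derive (0 : R) (1 : R) f 0.
Proof.
move=> C0 fC.
have f0 : f 0 = 0.
  by apply/eqP; rewrite -normr_le0; have := fC 0; rewrite expr0n mulr0.
suff L : h^-1 *: (f (h *: (1 : R) + 0) - f 0) @[h --> 0^'] --> (0 : R).
  by apply: DeriveDef; [apply/cvg_ex; exists 0|apply/cvg_lim].
apply/cvgrPdist_le => e e0; near=> h.
rewrite f0 sub0r normrN subr0 addr0 scaler1 normrM normfV.
have hn0 : h != 0 by near: h; exact: nbhs_dnbhs_neq.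
rewrite -ler_pdivlMl ?invr_gt0 ?normr_gt0// invrK.
apply: le_trans (fC h) _; rewrite -real_normK ?num_real// expr2 mulrA mulrC.
rewrite ler_wpM2l//.
(* Dividing by C + 1 covers the case C = 0. *)
apply: (@le_trans _ _ (C * (e / (C + 1)))).
  rewrite ler_wpM2l//; near: h; apply: dnbhs0_le; rewrite divr_gt0//.
  by rewrite ltr_wpDl.
rewrite mulrA ler_pdivrMr ?ltr_wpDl// mulrDr mulr1 mulrC lerDl.
exact: ltW.
Unshelve. all: by end_near. Qed.

Lemma is_derive_flat k t :
  is_derive t (1 : R) (flat k) (flat k.+2 t - k%:R * flat k.+1 t).
Proof.
have [t0|t0|->] := ltgtP t 0.
- rewrite /flat !ltNge (ltW t0) /= mulr0 subr0.
  apply: (@near_eq_is_derive _ _ _ (cst 0)).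
  near=> s; rewrite ltNge (_ : s <= 0)//.
  by apply/ltW; near: s; exact: lt_nbhsl.
- rewrite /flat t0 /=.
  apply: (@near_eq_is_derive _ _ _
    (((fun s : R => s^-1) ^+ k) * (expR \o (fun s : R => - s^-1)))).
    near=> s; rewrite (_ : 0 < s); last by near: s; exact: lt_nbhsr.
    rewrite [LHS]/= [(_ * _) s]/(_ * _).
    by rewrite -[((fun s : R => s^-1) ^+ k) s]/((_ ^+ k) s) exprfctE.
  have dV : is_derive t (1 : R) (fun s : R => s^-1) (- t ^- 2 *: 1).
    by apply: is_deriveV; rewrite ?gt_eqF.
  have dN : is_derive t (1 : R) (fun s : R => - s^-1) (- (- t ^- 2 *: 1)).
    exact: is_deriveN.
  have dE := @is_derive1_comp _ expR (fun s : R => - s^-1) t _ _ (is_derive_expR (- t^-1)) dN.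
  apply: is_derive_eq.
  rewrite /= exprfctE /GRing.scale /= !mulr1 opprK.
  by rewrite -!exprVn; case: k => [|k]; rewrite ?succnK ?[_ ^+ _.+1]exprS ?expr0; ring.
- have F0 j : flat j 0 = 0 by rewrite /flat ltxx.
  rewrite !F0 mulr0 subr0.
  apply: (@is_derive_quadratic _ (k.+2)`!%:R) => // s.
  have [s0|s0] := leP 0 s; first by rewrite ger0_norm ?flat_ge0// flat_le_sq.
  by rewrite /flat ltNge (ltW s0)/= normr0 mulr_ge0 ?sqr_ge0.
Unshelve. all: by end_near. Qed.

Lemma flat_derive1 k :
  (flat k)^`()%classic = flat k.+2 + (cst (- k%:R) * flat k.+1).
Proof.
apply: derive1_is_derive => t; apply: is_derive_eq (is_derive_flat k t) _.
by rewrite !fctE mulNr.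
Qed.

Lemma ck1_flat K k : ck1 K (flat k).
Proof.
have dk k' t : derivable (flat k') t 1 by have [] := is_derive_flat k' t.
elim: K k => [|K IH] k; split=> //.
rewrite flat_derive1; apply: ck1_add => //.
by apply: ck1_mul => //; exact: ck1_cst.
Qed.

Lemma flat0_mono s t : s <= t -> flat 0 s <= flat 0 t.
Proof.
move=> st; rewrite {1}/flat; case: ifPn => [s0|_]; last exact: flat_ge0.
have t0 := lt_le_trans s0 st.
rewrite /flat t0 !expr0 !mul1r ler_expR lerN2.
by rewrite lef_pV2 ?posrE.
Qed.


(* With c = [step_value] = exp(-2), [step] is 0 where t - 1/4 <= 0 and 1 where
   exp(-1/(t - 1/4)) >= c; composing avoids differentiating a quotient. *)
Definition step_value : R := flat 0 (2^-1).

Definition step (t : R) : R :=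
  1 - flat 0 (step_value - flat 0 (t - 4^-1)) / flat 0 step_value.

(* Amounts to exp 2 <= 10, obtained from exp(-1/4) >= 3/4. *)
Lemma step_value_lower : expR (- 10) <= flat 0 step_value.
Proof.
have vE : step_value = expR (- 2).
  by rewrite /step_value /flat invr_gt0 ltr0n expr0 mul1r invrK.
rewrite /flat vE expR_gt0 expr0 mul1r ler_expR lerN2 -expRN opprK.
have e4 : 3 / 4 <= expR (- 4^-1 : R).
  by apply: le_trans (expR_ge1Dx _); lra.
have e8 : (3 / 4) ^+ 8 <= expR (- 4^-1 : R) ^+ 8.
  by rewrite lerXn2r ?nnegrE ?expR_ge0//; lra.
have E : expR (- 4^-1 : R) ^+ 8 = (expR 2)^-1.
  by rewrite -expRM_natl -expRN; congr expR; field.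
move: e8; rewrite E => e8.
have p2 : 0 < expR 2 :> R by exact: expR_gt0.
rewrite -(ler_pM2l (_ : 0 < (expR 2)^-1)) ?invr_gt0// mulVf ?gt_eqF//.
(* (3/4)^8 = 6561/65536 barely exceeds 1/10. *)
have : (1 : R) <= (3 / 4) ^+ 8 * 10 by lra.
lra.
Qed.

Lemma step_value_gt0 : 0 < flat 0 step_value.
Proof. by apply: lt_le_trans step_value_lower; exact: expR_gt0. Qed.

Lemma step_range t : 0 <= step t <= 1.
Proof.
have v0 := step_value_gt0.
rewrite /step subr_ge0 ler_pdivrMr// mul1r flat0_mono/=; last first.
  by rewrite gerBl flat_ge0.
by rewrite gerBl divr_ge0 ?flat_ge0// ltW.
Qed.

Lemma step0 t : t <= 4^-1 -> step t = 0.
Proof.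
move=> t4; rewrite /step [flat 0 (t - _)]/flat subr_gt0 ltNge t4/=.
by rewrite subr0 divff ?subrr// gt_eqF// step_value_gt0.
Qed.

Lemma step1 t : 3 / 4 <= t -> step t = 1.
Proof.
move=> t4; rewrite /step [flat 0 (step_value - _)]/flat subr_gt0 ltNge.
rewrite (_ : step_value <= _) /= ?mul0r ?subr0//.
by apply: flat0_mono; lra.
Qed.

Lemma is_derive_subr (c t : R) : is_derive t (1 : R) (fun s : R => s - c) 1.
Proof.
apply: is_derive_eq (is_deriveB (is_derive_id t (1 : R)) (is_derive_cst c t 1)) _.
by rewrite subr0.
Qed.

Let arg (t : R) : R := step_value - flat 0 (t - 4^-1).

Lemma is_derive_arg t :
  is_derive t (1 : R) arg (- flat 2 (t - 4^-1)).
Proof.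
have dS := is_derive_subr 4^-1 t.
have dF := @is_derive1_comp _ (flat 0) _ t _ _ (is_derive_flat 0 _) dS.
have dB := is_deriveB (is_derive_cst step_value t (1 : R)) dF.
by apply: is_derive_eq dB _; rewrite mul0r subr0 mulr1 sub0r.
Qed.

Definition dstep (t : R) : R :=
  flat 2 (arg t) * flat 2 (t - 4^-1) / flat 0 step_value.

Lemma is_derive_step t : is_derive t (1 : R) step (dstep t).
Proof.
have dF := @is_derive1_comp _ (flat 0) arg t _ _ (is_derive_flat 0 _) (is_derive_arg t).
have dZ := is_deriveZ (flat 0 step_value)^-1 dF.
have dB := is_deriveB (is_derive_cst (1 : R) t (1 : R)) dZ.
have E : step = cst 1 - (flat 0 step_value)^-1 *: (flat 0 \o arg).
  by apply/funext => s; rewrite /step !fctE /GRing.scale /= mulrC.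
rewrite E; apply: is_derive_eq dB _.
by rewrite /dstep /GRing.scale /= mul0r subr0 sub0r !mulrN opprK mulrC.
Qed.

Definition d2step (t : R) : R :=
  ((flat 4 (t - 4^-1) - 2 * flat 3 (t - 4^-1)) * flat 2 (arg t)
   - (flat 4 (arg t) - 2 * flat 3 (arg t)) * flat 2 (t - 4^-1) ^+ 2)
  / flat 0 step_value.

Lemma is_derive_dstep t : is_derive t (1 : R) dstep (d2step t).
Proof.
have dS := is_derive_subr 4^-1 t.
have dF := @is_derive1_comp _ (flat 2) _ t _ _ (is_derive_flat 2 _) dS.
have dG := @is_derive1_comp _ (flat 2) arg t _ _ (is_derive_flat 2 _) (is_derive_arg t).
have dZ := is_deriveZ (flat 0 step_value)^-1 (is_deriveM dG dF).
have E : dstep = (flat 0 step_value)^-1 *: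
    ((flat 2 \o arg) * (flat 2 \o (fun s : R => s - 4^-1))).
  by apply/funext => s; rewrite /dstep !fctE /GRing.scale /= mulrC.
rewrite E; apply: is_derive_eq dZ _.
by rewrite /d2step /GRing.scale /=; ring.
Qed.

Lemma ck1_step K : ck1 K step.
Proof.
have cf := ck1_flat.
have caff (c : R) : ck1 K (fun s => s - c).
  have dc t : derivable (fun s => s - c) t 1 by have [] := is_derive_subr c t.
  case: K => [|K]; first by split.
  split=> //; rewrite (_ : (fun s : R => s - c)^`()%classic = cst (1 : R)); first exact: ck1_cst.
  by apply: derive1_is_derive => t; exact: is_derive_subr.
have -> : step = cst 1 + cst (- (flat 0 step_value)^-1) *
    (flat 0 \o (cst step_value + cst (-1) * (flat 0 \o (fun s => s - 4^-1)))).
  apply/funext => s; rewrite /step !fctE /=.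
  by rewrite mulN1r mulNr mulrC.
apply: ck1_add; first exact: ck1_cst.
apply: ck1_mul; first exact: ck1_cst.
apply: ck1_comp => //; apply: ck1_add; first exact: ck1_cst.
apply: ck1_mul; first exact: ck1_cst.
exact: ck1_comp.
Qed.

Lemma cutoff_step : cutoff step.
Proof.
split.
- by move=> k t; apply: ck1_derive1n => K; exact: ck1_step.
- exact: step_range.
- by move=> t t0; apply: step0; lra.
- by move=> t t1; apply: step1; lra.
- split.
    near=> t; have t4 : t < 4^-1 by near: t; apply: lt_nbhsl; lra.
    by rewrite !step0//; lra.
  near=> t; have t4 : 3 / 4 < t by near: t; apply: lt_nbhsr; lra.
  by rewrite !step1//; lra.
Unshelve. all: by end_near. Qed.

Let flat_bounds k t : 0 <= flat k t <= k`!%:R.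
Proof. by rewrite flat_ge0 flat_le. Qed.

(** The number 216 is 36 * 2 + 36 * 4, the bound for the numerator of [d2step] obtained from
    [flat k] <= k!. The factor e^10 bounds the inverse of the denominator. *)
Lemma step_quotient_bound (x : R) : `|x| <= 216 ->
  `|x / flat 0 step_value| <= 216 * expR 10.
Proof.
move=> xb; have v0 := step_value_gt0.
rewrite normrM (gtr0_norm (_ : 0 < _^-1)) ?invr_gt0//.
apply: ler_pM => //; first by rewrite invr_ge0 ltW.
rewrite -[expR 10]invrK lef_pV2 ?posrE ?invr_gt0 ?expR_gt0// -expRN.
exact: step_value_lower.
Qed.

Lemma dstep_bound t : `|dstep t| <= 216 * expR 10.
Proof.
apply: step_quotient_bound.
have := flat_bounds 2 (arg t); have := flat_bounds 2 (t - 4^-1).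
rewrite (_ : 2`! = 2)//.
move: (flat 2 _) (flat 2 _) => a b /andP[a0 a2] /andP[b0 b2].
rewrite ler_norml; apply/andP; split; nra.
Qed.

Lemma d2step_bound t : `|d2step t| <= 216 * expR 10.
Proof.
apply: step_quotient_bound.
have := flat_bounds 2 (arg t); have := flat_bounds 2 (t - 4^-1).
have := flat_bounds 3 (arg t); have := flat_bounds 3 (t - 4^-1).
have := flat_bounds 4 (arg t); have := flat_bounds 4 (t - 4^-1).
rewrite (_ : 2`! = 2)// (_ : 3`! = 6)// (_ : 4`! = 24)//.
move: (flat 4 _) (flat 4 _) (flat 3 _) (flat 3 _) (flat 2 _) (flat 2 _).
move=> a4 b4 a3 b3 a2 b2 /andP[? ?] /andP[? ?] /andP[? ?] /andP[? ?] /andP[? ?] /andP[? ?].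
have na : `|a4 - 2 * a3| <= 36 by rewrite ler_norml; lra.
have nb : `|b4 - 2 * b3| <= 36 by rewrite ler_norml; lra.
apply: le_trans (ler_normB _ _) _; rewrite !normrM.
have na2 : `|a2| <= 2 by rewrite ler_norml; lra.
have nb2 : `|b2| <= 2 by rewrite ler_norml; lra.
have h1 : `|b4 - 2 * b3| * `|a2| <= 36 * 2 by apply: ler_pM.
have h2 : `|b2| * `|b2| <= 2 * 2 by apply: ler_pM.
have h3 : `|a4 - 2 * a3| * (`|b2| * `|b2|) <= 36 * (2 * 2).
  by apply: ler_pM => //; rewrite mulr_ge0.
lra.
Qed.

End Cutoff.

(** * C^2 bounds *)

Section C2Bounds.
Variables (R : realType) (n : nat).
Implicit Types (U : set 'rV[R]_n) (f : 'rV[R]_n -> R).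

(** [partial] is total, so bounds on its values alone would not survive sums and products; the
    clause [ck 1] supplies the differentiability that the Leibniz rule consumes. *)
Definition C2_bounded U f (B : R) : Prop :=
  ck 1 U f /\ forall z, U z ->
    [/\ `|f z| <= B, forall i, `|partial i f z| <= B
      & forall i j, `|partial i (partial j f) z| <= B].

Lemma C2_bounded_partials U f B s z :
  C2_bounded U f B -> U z -> (size s <= 2)%N -> `|partials s f z| <= B.
Proof.
move=> [_ bf] Uz; have [b0 b1 b2] := bf z Uz.
by case: s => [|i [|j [|k s]]] // _; [exact: b1|exact: b2].
Qed.

Lemma C2_bounded_of_partials U f B : ck 1 U f ->
  (forall s z, U z -> (size s <= 2)%N -> `|partials s f z| <= B) ->
  C2_bounded U f B.
Proof.
move=> cf bf; split=> // z Uz; split=> [|i|i j].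
- exact: (bf [::]).
- exact: (bf [:: i]).
- exact: (bf [:: i; j]).
Qed.

Lemma C2_bounded_ext U f g B : open U -> {in U, f =1 g} ->
  C2_bounded U f B -> C2_bounded U g B.
Proof.
move=> Uo fg bf; apply: C2_bounded_of_partials.
  exact: ck_ext fg bf.1.
move=> s z Uz s2; rewrite -(partials_ext Uo s fg) ?inE//.
exact: C2_bounded_partials bf Uz s2.
Qed.

Lemma C2_bounded_le U f B B' : B <= B' -> C2_bounded U f B -> C2_bounded U f B'.
Proof.
move=> BB' [cf bf]; split=> // z Uz; have [b0 b1 b2] := bf z Uz.
by split=> [|i|i j]; apply: le_trans BB'.
Qed.

Lemma C2_bounded_subset U V f B : V `<=` U -> C2_bounded U f B -> C2_bounded V f B.
Proof.
move=> VU [cf bf]; split; first exact: ck_subset VU cf.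
by move=> z /VU; exact: bf.
Qed.

Lemma C2_bounded_cst U (c : R) : open U -> C2_bounded U (cst c) `|c|.
Proof.
move=> Uo; split; first exact: ck_cst.
move=> z Uz; split=> // [i|i j]; first by rewrite /partial derive_cst normr0.
have -> : partial j (cst c) = cst 0.
  by apply/funext => x; rewrite /partial derive_cst.
by rewrite /partial derive_cst normr0.
Qed.

Lemma partialD f g i z : differentiable f z -> differentiable g z ->
  partial i (f \+ g) z = partial i f z + partial i g z.
Proof. by move=> df dg; rewrite /partial deriveD//; exact: diff_derivable. Qed.

Lemma partialM f g i z : differentiable f z -> differentiable g z ->
  partial i (f \* g) z = f z * partial i g z + g z * partial i f z.
Proof. by move=> df dg; rewrite /partial deriveM//; exact: diff_derivable. Qed.

Lemma C2_bounded_add U f g B B' : open U ->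
  C2_bounded U f B -> C2_bounded U g B' -> C2_bounded U (f \+ g) (B + B').
Proof.
move=> Uo [cf bf] [cg bg]; split; first exact: ck_add.
have d1 i : {in U, partial i (f \+ g) =1 partial i f \+ partial i g}.
  move=> x; rewrite inE => Ux; apply: partialD; first exact: ck_diff cf Ux.
  exact: ck_diff cg Ux.
move=> z Uz; have [f0 f1 f2] := bf z Uz; have [g0 g1 g2] := bg z Uz.
have tri (x y : R) : `|x| <= B -> `|y| <= B' -> `|x + y| <= B + B'.
  by move=> xB yB; apply: le_trans (ler_normD _ _) _; exact: lerD.
split=> [|i|i j]; first exact: tri.
  by rewrite d1 ?inE//; exact: tri.
rewrite (partial_ext Uo i (d1 j)) ?inE// partialD; first exact: tri.
  exact: ck_diff (ckSP cf j) Uz.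
exact: ck_diff (ckSP cg j) Uz.
Qed.

(** The constant 4 counts the terms in the Leibniz expansion of a second derivative. *)
Lemma C2_bounded_mul U f g B B' : open U ->
  C2_bounded U f B -> C2_bounded U g B' -> C2_bounded U (f \* g) (4 * B * B').
Proof.
move=> Uo [cf bf] [cg bg]; split; first exact: ck_mul.
have df x : U x -> differentiable f x by exact: ck_diff cf.
have dg x : U x -> differentiable g x by exact: ck_diff cg.
have d1f x i : U x -> differentiable (partial i f) x.
  exact: ck_diff (ckSP cf i).
have d1g x i : U x -> differentiable (partial i g) x.
  exact: ck_diff (ckSP cg i).
have d1 i : {in U, partial i (f \* g) =1 (f \* partial i g) \+ (g \* partial i f)}.
  by move=> x; rewrite inE => Ux; rewrite partialM; [|exact: df|exact: dg].
move=> z Uz; have [f0 f1 f2] := bf z Uz; have [g0 g1 g2] := bg z Uz.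
have B0 : 0 <= B by apply: le_trans f0.
have B'0 : 0 <= B' by apply: le_trans g0.
have P0 : 0 <= B * B' by exact: mulr_ge0.
have mb (x y : R) : `|x| <= B -> `|y| <= B' -> `|x * y| <= B * B'.
  by move=> xB yB; rewrite normrM; exact: ler_pM.
have mb' (x y : R) : `|x| <= B' -> `|y| <= B -> `|x * y| <= B * B'.
  by move=> xB yB; rewrite mulrC; exact: mb.
rewrite -mulrA; move: (B * B') P0 mb mb' => P P0 mb mb'.
have tri (x y : R) : `|x| <= P -> `|y| <= P -> `|x + y| <= 2 * P.
  by move=> xP yP; apply: le_trans (ler_normD _ _) _; lra.
have quad (x y s t : R) : `|x| <= P -> `|y| <= P -> `|s| <= P -> `|t| <= P ->
    `|x + y + (s + t)| <= 4 * P.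
  move=> xP yP sP tP; apply: le_trans (ler_normD _ _) _.
  by have := tri _ _ xP yP; have := tri _ _ sP tP; lra.
split=> [|i|i j].
- by apply: le_trans (mb _ _ f0 g0) _; lra.
- rewrite d1 ?inE//=; apply: le_trans (tri _ _ (mb _ _ f0 (g1 i)) (mb' _ _ g0 (f1 i))) _.
  lra.
- rewrite (partial_ext Uo i (d1 j)) ?inE// partialD; first last.
    by apply: differentiableM; [exact: dg|exact: d1f].
    by apply: differentiableM; [exact: df|exact: d1g].
  rewrite !partialM; [|exact: dg|exact: d1f|exact: df|exact: d1g].
  exact: quad (mb _ _ f0 (g2 i j)) (mb' _ _ (g1 j) (f1 i))
    (mb' _ _ g0 (f2 i j)) (mb _ _ (f1 j) (g1 i)).
Qed.

End C2Bounds.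

(** * Functions of t alone and slices t = b *)

Section Model.
Variables (R : realType) (m : nat).
Implicit Types (U : set 'rV[R]_m.+1) (z : 'rV[R]_m.+1).

Lemma differentiable_entry n (z : 'rV[R]_n) j :
  differentiable (fun y : 'rV[R]_n => y 0 j) z.
Proof. exact: differentiable_coord. Qed.

Lemma partial_entry n (z : 'rV[R]_n) i j :
  partial i (fun y : 'rV[R]_n => y 0 j) z = (i == j)%:R.
Proof.
rewrite /partial -(@derive_entry _ _ _ _ id)//.
by rewrite derive_id /basis_vec mxE eqxx eq_sym.
Qed.

Lemma ck_entry n (U : set 'rV[R]_n) K j : open U -> ck K U (fun y => y 0 j).
Proof.
have de (z : 'rV[R]_n) : U z -> differentiable (fun y : 'rV[R]_n => y 0 j) z.
  by move=> _; exact: differentiable_entry.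
move=> Uo; case: K => [|K]; split=> // i.
rewrite (_ : partial i _ = cst ((i == j)%:R : R)); first exact: ck_cst.
by apply/funext => z; rewrite partial_entry.
Qed.

Lemma partial_comp_tpart (u : R -> R) du z i :
  is_derive (tpart z) (1 : R) u du ->
  differentiable (u \o @tpart R m) z /\
  partial i (u \o @tpart R m) z = (i == ord_max)%:R * du.
Proof.
move=> [/derivable1_diffP dU uE].
have dt : differentiable (@tpart R m) z by exact: differentiable_entry.
have duz := differentiable_comp dt dU.
split=> //; rewrite /partial (deriveE _ duz) diff_comp//=.
rewrite -(@deriveE _ _ _ (@tpart R m) z _ dt).
rewrite -/(partial i (@tpart R m) z) (partial_entry z i ord_max).
by rewrite -[X in 'd u _ X]mulr1 [LHS]linearZ/= -uE deriveE.
Qed.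

Lemma C2_bounded_tpart U (u du ddu : R -> R) B : open U ->
  (forall t, is_derive t (1 : R) u (du t)) ->
  (forall t, is_derive t (1 : R) du (ddu t)) ->
  (forall z, U z ->
    [/\ `|u (tpart z)| <= B, `|du (tpart z)| <= B & `|ddu (tpart z)| <= B]) ->
  C2_bounded U (u \o @tpart R m) B.
Proof.
move=> Uo hu hdu bnd.
have mbool (b : bool) (x : R) : 0 <= B -> `|x| <= B -> `|b%:R * x| <= B.
  by case: b; rewrite ?mul1r// mul0r normr0.
have d1 i : partial i (u \o @tpart R m) =
    cst (i == ord_max)%:R \* (du \o @tpart R m).
  by apply/funext => z; have [_ ->] := partial_comp_tpart i (hu (tpart z)).
have d1D i z : differentiable (du \o @tpart R m) z /\
    partial i (du \o @tpart R m) z = (i == ord_max)%:R * ddu (tpart z).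
  exact: partial_comp_tpart.
have diff0 z := (partial_comp_tpart ord_max (hu (tpart z))).1.
split.
  split=> [z _|i]; first exact: diff0.
  rewrite d1; split=> // z _; apply: differentiableM => //.
  exact: (d1D i z).1.
move=> z Uz; have [b0 b1 b2] := bnd z Uz.
have B0 : 0 <= B by exact: le_trans b0.
split=> // [i|i j]; first by rewrite d1; exact: mbool.
rewrite d1 partialM//; last exact: (d1D i z).1.
rewrite [X in _ + _ * X](_ : _ = 0); last by rewrite /partial derive_cst.
by rewrite mulr0 addr0 (d1D i z).2 /=; apply: (mbool) => //; exact: mbool.
Qed.

Definition slice (b : R) z : 'rV[R]_m.+1 :=
  \row_j (if j == ord_max then b else z 0 j).

Lemma tpart_slice b z : tpart (slice b z) = b.
Proof. by rewrite /tpart mxE eqxx. Qed.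

Lemma xpart_slice b z : xpart (slice b z) = xpart z.
Proof. by apply/rowP => j; rewrite !mxE eq_sym (negPf (neq_lift _ _)). Qed.

Lemma slice_entry b j : (fun z => slice b z 0 j) =
  if j == ord_max then cst b else (fun z => z 0 j).
Proof. by apply/funext => z; rewrite mxE; case: ifP. Qed.

Lemma differentiable_slice b z : differentiable (slice b) z.
Proof.
apply/differentiable_mxP => i j; rewrite (ord1 i) slice_entry.
by case: ifP => _; [exact: differentiable_cst|exact: differentiable_entry].
Qed.

Lemma partial_slice b z i j :
  partial i (fun y => slice b y 0 j) z = ((i == j) && (j != ord_max))%:R.
Proof.
rewrite slice_entry; case: ifP => _ /=; last by rewrite partial_entry andbT.
by rewrite andbF /partial derive_cst.
Qed.

Lemma partial_comp_slice b (f : 'rV[R]_m.+1 -> R) z i :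
  differentiable f (slice b z) ->
  partial i (f \o slice b) z = (i != ord_max)%:R * partial i f (slice b z).
Proof.
move=> df; rewrite (partial_comp i (differentiable_slice b z) df).
rewrite (bigD1 i)//= big1 ?addr0 => [|j ji]; rewrite partial_slice ?eqxx//.
by rewrite eq_sym (negPf ji) mul0r.
Qed.

(** Every derivative of the composite is either zero, when the t-direction occurs, or the same
    derivative of f on the slice; the bound is therefore kept without loss. *)
Lemma C2_bounded_slice U V b f B : open U -> (forall z, U z -> V (slice b z)) ->
  C2_bounded V f B -> C2_bounded U (f \o slice b) B.
Proof.
move=> Uo UV [cf bf].
have cslice K j : ck K U (fun z => slice b z 0 j).
  rewrite slice_entry; case: ifP => _; first exact: ck_cst.
  exact: ck_entry.
split.
  by apply: (ck_comp Uo _ cf) => // _ [z Uz <-]; exact: UV.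
have d1 i : {in U, partial i (f \o slice b) =1
    cst (i != ord_max)%:R \* (partial i f \o slice b)}.
  move=> z; rewrite inE => Uz; apply: partial_comp_slice.
  exact: ck_diff cf (UV _ Uz).
have mbool (c : bool) (x : R) : 0 <= B -> `|x| <= B -> `|c%:R * x| <= B.
  by case: c; rewrite ?mul1r// mul0r normr0.
move=> z Uz; have [b0 b1 b2] := bf _ (UV _ Uz).
have B0 : 0 <= B by exact: le_trans b0.
split=> [|i|i j]; first exact: b0.
  by rewrite d1 ?inE//=; exact: mbool.
have dj : differentiable (partial j f) (slice b z).
  exact: ck_diff (ckSP cf j) (UV _ Uz).
rewrite (partial_ext Uo i (d1 j)) ?inE// partialM//; last first.
  by apply: differentiable_comp => //; exact: differentiable_slice.
rewrite [X in _ + _ * X](_ : _ = 0); last by rewrite /partial derive_cst.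
rewrite mulr0 addr0 partial_comp_slice//.
by rewrite /=; apply: (mbool) => //; exact: mbool.
Qed.

End Model.

(** * Warp forcing in a radial chart *)

Lemma congruence_proj (R : comPzRingType) n (J G : 'M[R]_n) (k i j : 'I_n) :
  (forall a b, J a b = ((a == b) && (b != k))%:R) ->
  (J *m G *m J^T) i j = if (i == k) || (j == k) then 0 else G i j.
Proof.
move=> Js; rewrite congruence_entry.
rewrite (bigD1 j)//= [X in _ + X]big1 ?addr0; last first.
  by move=> l lj; rewrite Js eq_sym (negPf lj) mulr0.
rewrite (bigD1 i)//= [X in _ + X]big1 ?addr0; last first.
  by move=> l li; rewrite Js eq_sym (negPf li) mul0r.
rewrite !Js !eqxx /=.
by case: eqP; case: eqP => /= _ _; rewrite ?mulr0 ?mul0r ?mulr1 ?mul1r.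
Qed.

Lemma mx_combination (R : pzRingType) n (c d : R) (A B : 'M[R]_n) i j :
  (c *: A + d *: B) i j = c * A i j + d * B i j.
Proof. by rewrite !mxE. Qed.

Lemma mx_scale_add (R : pzRingType) n (c : R) (A B : 'M[R]_n) i j :
  (c *: A + B) i j = c * A i j + B i j.
Proof. by rewrite !mxE. Qed.

Section WarpChart.
Variables (R : realType) (m : nat) (M : manifold R m.+1) (g : tensor M) (o : M).
Variables (E : 'rV[R]_m.+1 -> M) (L : M -> 'rV[R]_m.+1).

Implicit Type z : 'rV[R]_m.+1.

Lemma tangent_normZ (p : M) (c : R) v :
  0 <= c -> tangent_norm g p (c *: v) = c * tangent_norm g p v.
Proof.
move=> c0; rewrite /tangent_norm linearZ/= -scalemxAr -!scalemxAl scalerA.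
by rewrite mxE -expr2 sqrtrM ?sqr_ge0// sqrtr_sqr ger0_norm.
Qed.

Variables (xi r0 a : R) (phi : 'rV[R]_m.+1 -> M) (psi : M -> 'rV[R]_m.+1).
Variable (phi1 : 'rV[R]_m -> 'rV[R]_m.+1).
Hypothesis EK : forall v, L (E v) = v.
Hypothesis phi_diffeo : diffeo (model xi) (phi @` model xi) phi psi.
Hypothesis phi1_unit : forall x : 'rV[R]_m, unit_ball x -> tangent_norm g o (phi1 x) = 1.
Hypothesis phi_radial : forall z : 'rV[R]_m.+1, model xi z ->
  0 < tpart z + a /\ phi z = E ((tpart z + a) *: phi1 (xpart z)).

Let U : set 'rV[R]_m.+1 := model xi.
Let Uo : open U. Proof. by case: phi_diffeo. Qed.
Let Vo : open (phi @` U). Proof. by case: phi_diffeo. Qed.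
Let phi_smooth : smooth_from U phi. Proof. by case: phi_diffeo => _ _ _ _ []. Qed.
Let psi_smooth : smooth_to (phi @` U) psi.
Proof. by case: phi_diffeo => _ _ _ _ []. Qed.
Let phiK z : U z -> psi (phi z) = z.
Proof. by case: phi_diffeo => _ _ _ H _; exact: H. Qed.

Lemma radius_chart z : model xi z -> radius g o L (phi z) = tpart z + a.
Proof.
move=> Uz; have [t0 ->] := phi_radial Uz.
by rewrite /radius EK tangent_normZ ?ltW// phi1_unit ?mulr1//; case: Uz.
Qed.

Hypothesis b_range : - 1 - xi < r0 - a < 1 + xi.
Let b := r0 - a.

Lemma slice_model xi' z : model xi' z -> model xi (slice b z).
Proof. by move=> [Uz _]; split; [rewrite xpart_slice|rewrite tpart_slice]. Qed.

Lemma radial_proj_chart z : model xi z ->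
  radial_proj g o E L r0 (phi z) = phi (slice b z).
Proof.
move=> Uz; rewrite /radial_proj radius_chart//; have [t0 ->] := phi_radial Uz.
rewrite (phi_radial (slice_model Uz)).2 xpart_slice tpart_slice EK scalerA.
by rewrite divfK ?gt_eqF// subrK.
Qed.

(** Points of M close to [phi z] are images under phi, so there [radius] and [radial_proj] factor
    through psi followed by [tpart] or [slice], and inherit their differentiability from these
    maps. *)
Lemma near_chart z : model xi z ->
  \forall y \near coord (phi z) (phi z), exists2 z', model xi z' &
    [/\ psi (param (phi z) y) = z' & param (phi z) y = phi z'].
Proof.
move=> Uz; set q := phi z.
have qq : param q (coord q q) = q by rewrite coordK//; exact: dom_center.
have cq : {for coord q q, continuous (param q)}.
  by apply: param_continuous; exists q => //; exact: dom_center.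
have : \forall y \near coord q q, (phi @` U) (param q y).
  by apply: cq; apply: open_nbhs_nbhs; split=> //; rewrite qq; exists z.
by apply: filterS => y [z' Uz' E']; exists z' => //; rewrite -E' phiK.
Qed.

Lemma differentiable_chart_inverse z : model xi z ->
  differentiable (psi \o param (phi z)) (coord (phi z) (phi z)).
Proof.
move=> Uz; apply: (psi_smooth (p := phi z) [::]).
by exists (phi z) => //; split; [exists z|exact: dom_center].
Qed.

Let param_center z : param (phi z) (coord (phi z) (phi z)) = phi z.
Proof. by rewrite coordK//; exact: dom_center. Qed.

Let phi_cont z : U z -> {for z, continuous phi}.
Proof. exact: phi_smooth.1. Qed.

Let dphi z : U z -> differentiable (coord (phi z) \o phi) z.
Proof. by move=> Uz; apply: differentiable_chart phi_smooth Uz _; exact: dom_center. Qed.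

Lemma near_model (P : 'rV[R]_m.+1 -> Prop) z : model xi z ->
  (forall z', model xi z' -> P z') -> \forall z' \near z, P z'.
Proof.
move=> Uz UP; have : \forall z' \near z, U z' by exact: open_nbhs_nbhs.
by apply: filterS.
Qed.

Lemma pullback_radial_proj z i j : model xi z ->
  pullback phi (pullback_self (radial_proj g o E L r0) g) z i j =
  if (i == ord_max) || (j == ord_max) then 0 else pullback phi g (slice b z) i j.
Proof.
move=> Uz; have Ub := slice_model Uz; set P := radial_proj g o E L r0.
have Pq : P (phi z) = phi (slice b z) := radial_proj_chart Uz.
have dP : differentiable (coord (P (phi z)) \o P \o param (phi z))
    (coord (phi z) (phi z)).
  rewrite Pq; set s := phi (slice b z).
  apply: (@near_eq_differentiable _ _ _
    ((coord s \o phi) \o (slice b \o (psi \o param (phi z))))).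
    apply: filterS (near_chart Uz) => y [z' Uz' [/= -> ->]].
    by rewrite /P radial_proj_chart.
  apply: differentiable_comp.
    apply: differentiable_comp; first exact: differentiable_chart_inverse.
    exact: differentiable_slice.
  by rewrite /= param_center phiK//; exact: dphi.
rewrite pullback_pullback_self//; [|exact: phi_cont|exact: dphi].
have nearPphi : \forall z' \near z, (phi \o slice b) z' = (P \o phi) z'.
  by apply: near_model => // z' Uz'; rewrite /= /P radial_proj_chart.
rewrite -(near_eq_pullback g nearPphi); last first.
  rewrite -[_ \o _]/((coord (phi (slice b z)) \o phi) \o slice b).
  by apply: differentiable_comp; [exact: differentiable_slice|exact: dphi].
have Ec := pullback_comp g (differentiable_slice b z) (dphi Ub).
rewrite [pullback (phi \o slice b) g z]Ec; apply: congruence_proj => k l.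
by rewrite (jacobian_entry k l (differentiable_slice b z)) partial_slice.
Qed.

Lemma pullback_dr z i j : model xi z ->
  pullback phi (fun p => differential (radius g o L) p *m
    (differential (radius g o L) p)^T) z i j =
  ((i == ord_max) && (j == ord_max))%:R.
Proof.
move=> Uz.
have dr : differentiable (radius g o L \o param (phi z)) (coord (phi z) (phi z)).
  apply: (@near_eq_differentiable _ _ _
    ((@tpart R m \o (psi \o param (phi z))) \+ cst a)).
    apply: filterS (near_chart Uz) => y [z' Uz' [/= -> ->]].
    by rewrite radius_chart.
  apply: differentiableD; last exact: differentiable_cst.
  apply: differentiable_comp; first exact: differentiable_chart_inverse.
  exact: differentiable_entry.
rewrite (pullback_differential (phi_cont Uz) (dphi Uz) dr) mxE.
have pr k : partial k (radius g o L \o phi) z = (k == ord_max)%:R.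
  have nearr : \forall z' \near z, (@tpart R m \+ cst a) z' = (radius g o L \o phi) z'.
    by apply: near_model => // z' Uz'; rewrite /= radius_chart.
  rewrite /partial -(near_eq_derive _ nearr) -/(partial k _ z) partialD//.
    by rewrite (partial_entry z k ord_max) /partial derive_cst addr0.
  exact: differentiable_entry.
by rewrite !pr -natrM mulnb.
Qed.

Definition warp_factor (t : R) : R := sinh (t + a) ^+ 2 / sinh r0 ^+ 2.

Lemma pullback_warp_forced (rho : R -> R) z i j : model xi z ->
  let w := rho (2 * (tpart z + a) - 2 * r0) in
  pullback phi (warp_forced rho g o E L r0) z i j =
  (1 - w) * (if (i == ord_max) || (j == ord_max)
             then ((i == ord_max) && (j == ord_max))%:R
             else warp_factor (tpart z) * pullback phi g (slice b z) i j)
  + w * pullback phi g z i j.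
Proof.
move=> Uz w; rewrite /warp_forced pullbackD !pullbackZ radius_chart// -/w.
rewrite /warped_metric pullbackD pullbackZ radius_chart//.
rewrite [LHS]mx_combination [X in _ * X + _]mx_scale_add.
congr (_ * _ + _).
apply: etrans (congr2 +%R (congr1 ( *%R _) (pullback_radial_proj i j Uz))
  (pullback_dr i j Uz)) _.
rewrite mul1r.
by case: eqP; case: eqP => /= _ _; rewrite ?mulr0 ?add0r ?addr0.
Qed.

Lemma diffeo_restrict (U' : set 'rV[R]_m.+1) : open U' -> U' `<=` model xi ->
  diffeo U' (phi @` U') phi psi.
Proof.
move=> U'o U'U.
have psi_cont q : (phi @` U) q -> {for q, continuous psi}.
  move=> Vq; have dq := dom_center q.
  have dpsi : differentiable (psi \o param q) (coord q q).
    by apply: (psi_smooth (p := q) [::]); exists q.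
  have : {for q, continuous ((psi \o param q) \o coord q)}.
    apply: continuous_comp; first exact: coord_continuous.
    exact: differentiable_continuous.
  rewrite /prop_for /continuous_at /= coordK// => H.
  apply: cvg_trans H; apply: near_eq_cvg.
  have : \forall q' \near q, dom q q'.
    by apply: open_nbhs_nbhs; split=> //; exact: dom_open.
  by apply: filterS => q' dq' /=; rewrite coordK.
split=> //.
- rewrite openE => _ [z U'z <-]; have Uz := U'U _ U'z.
  have Vz : (phi @` U) (phi z) by exists z.
  have n1 : \forall q \near phi z, (phi @` U) q by exact: open_nbhs_nbhs.
  have n2 : \forall q \near phi z, U' (psi q).
    by apply: (psi_cont _ Vz); apply: open_nbhs_nbhs; split=> //; rewrite phiK.
  rewrite /interior; near=> q.
  have : (phi @` U) q by near: q.
  move=> [z' Uz' E']; exists z' => //.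
  rewrite -(phiK Uz') E'; near: q; exact: n2.
- by move=> z /U'U; exact: phiK.
- split; first split.
  + by move=> z /U'U; exact: phi_cont.
  + by move=> p s x [/U'U Ux Dx]; exact: phi_smooth.2.
  + move=> p s x [q [[z U'z zq] Dq] qx]; apply: psi_smooth.
    by exists q => //; split=> //; exists z => //; exact: U'U.
Unshelve. all: by end_near. Qed.

End WarpChart.

(** * Explicit estimates *)

Section Estimates.
Variable R : realType.

Lemma C2norm_lt_bounded n k (U : set 'rV[R]_n) (F : 'rV[R]_n -> 'M[R]_k) B i j :
  ck 1 U (fun z => F z i j) -> (C2norm U F < B%:E)%E ->
  C2_bounded U (fun z => F z i j) B.
Proof.
move=> cF FB; apply: C2_bounded_of_partials => // s z Uz s2.
rewrite -lee_fin; apply/ltW; apply: le_lt_trans FB.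
by apply: ereal_sup_ubound; exists z, i, j, s.
Qed.

Lemma C2norm_le n k (U : set 'rV[R]_n) (F : 'rV[R]_n -> 'M[R]_k) B :
  (forall i j, C2_bounded U (fun z => F z i j) B) -> (C2norm U F <= B%:E)%E.
Proof.
move=> bF; apply: ge_ereal_sup => _ [z [i [j [s [Uz s2 ->]]]]].
by rewrite lee_fin; exact: C2_bounded_partials (bF i j) Uz s2.
Qed.

Lemma open_model m (xi : R) : open (model xi : set 'rV[R]_m.+1).
Proof.
have ct : continuous (@tpart R m).
  by move=> z; apply: differentiable_continuous; exact: differentiable_entry.
pose sq z : R := (\sum_(j < m) (fun y : 'rV[R]_m.+1 => y 0 (lift ord_max j)) ^+ 2) z.
have csq : continuous sq.
  move=> z; apply: differentiable_continuous; apply: differentiable_sum => j.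
  by apply: differentiableX; exact: differentiable_entry.
rewrite (_ : model xi = sq @^-1` [set x | x < 1]
    `&` (@tpart R m @^-1` [set x | - 1 - xi < x] `&` @tpart R m @^-1` [set x | x < 1 + xi])).
  apply: openI; first by apply: open_comp => // z _; exact: csq.
  apply: openI; apply: open_comp.
  - by move=> z _; exact: ct.
  - exact: open_gt.
  - by move=> z _; exact: ct.
  - exact: open_lt.
apply/seteqP; split => z /=.
  move=> [Uz /andP[t1 t2]]; split=> //; move: Uz; rewrite /unit_ball /= /sq fct_sumE.
  by under eq_bigr do rewrite mxE.
move=> [Uz [t1 t2]]; split; last by rewrite t1.
move: Uz; rewrite /unit_ball /= /sq fct_sumE.
by under [in X in _ -> X]eq_bigr do rewrite mxE.
Qed.

(** The span of e^(2t), 1 and e^(-2t) contains the squares of translates of sinh and is closed under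
    differentiation, so a single estimate serves all derivatives up to order two. *)
Definition expc (al be ga t : R) : R :=
  al * expR (2 * t) + be + ga * expR (- (2 * t)).

Lemma is_derive_expc al be ga t :
  is_derive t (1 : R) (expc al be ga) (expc (2 * al) 0 (- (2 * ga)) t).
Proof.
have dL (c : R) : is_derive t (1 : R) (fun s => c * s) c.
  apply: is_derive_eq (is_deriveZ c (is_derive_id t (1 : R))) _.
  by rewrite /GRing.scale /= mulr1.
have dE (c : R) := @is_derive1_comp _ expR (fun s => c * s) t _ _
  (is_derive_expR (c * t)) (dL c).
have dD := is_deriveD (is_deriveD (is_deriveZ al (dE 2)) (is_derive_cst be t (1 : R)))
  (is_deriveZ ga (dE (- 2))).
have E : expc al be ga = al *: (expR \o (fun s => 2 * s)) + cst be
    + ga *: (expR \o (fun s => - 2 * s)).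
  by apply/funext => s; rewrite /expc !fctE /GRing.scale /= mulNr.
rewrite E; apply: is_derive_eq dD _.
by rewrite /expc /GRing.scale /= mulNr; ring.
Qed.

(** The factor 4 comes from the second derivative of e^(2t) and of e^(-2t). *)
Lemma C2_bounded_expc m (U : set 'rV[R]_m.+1) al be ga B : open U ->
  (forall z, U z -> 4 * (`|al| * expR (2 * tpart z) + `|be|
     + `|ga| * expR (- (2 * tpart z))) <= B) ->
  C2_bounded U (expc al be ga \o @tpart R m) B.
Proof.
move=> Uo bU; apply: (C2_bounded_tpart Uo (is_derive_expc al be ga)
  (is_derive_expc _ _ _)) => z /bU; rewrite /expc.
move: (expR (2 * tpart z)) (expR (- (2 * tpart z))) (expR_gt0 (2 * tpart z))
  (expR_gt0 (- (2 * tpart z))) => Y X Y0 X0 bB.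
have tri (x y s : R) : `|x * Y + y + s * X| <= `|x| * Y + `|y| + `|s| * X.
  apply: le_trans (ler_normD _ _) _; apply: lerD.
    by apply: le_trans (ler_normD _ _) _; rewrite normrM (gtr0_norm Y0).
  by rewrite normrM (gtr0_norm X0).
have h1 : 0 <= `|al| * Y by rewrite mulr_ge0// ltW.
have h2 : 0 <= `|ga| * X by rewrite mulr_ge0// ltW.
have h3 := normr_ge0 be.
have n2 : `|2 : R| = 2 by rewrite ger0_norm.
split; apply: le_trans (tri _ _ _) _; rewrite ?normrN ?normrM ?normrN ?normrM ?n2 ?normr0; lra.
Qed.

Lemma expR_mono (x y : R) : x <= y -> expR x <= expR y.
Proof. by rewrite ler_expR. Qed.

Lemma expR10_ge : 1024 <= expR 10 :> R.
Proof.
have e1 : 2 <= expR 1 :> R by apply: le_trans (expR_ge1Dx _); lra.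
have -> : expR 10 = expR 1 ^+ 10 :> R by rewrite -expRM_natl mulr1.
have -> : 1024 = 2 ^+ 10 :> R by rewrite -natrX.
by rewrite lerXn2r// nnegrE ltW// expR_gt0.
Qed.

(** * Size of the warp factor and of its deviation from the hyperbolic one *)

Section Numbers.
Variables (xi r0 a : R).
Hypotheses (xi1 : 1 < xi) (r0xi : 3 + 2 * xi <= r0).
Hypotheses (a_lower : r0 - 1 - xi < a) (a_upper : a < r0 + 2^-1 + xi).

(** Four times [sinh r0 ^+ 2]. The bound 1/K <= 2 e^(-2 r0) is the source of every factor e^(-2 r0)
    below. *)
Let K : R := (expR r0 - expR (- r0)) ^+ 2.

Let P0 : 0 < expR (2 * r0). Proof. exact: expR_gt0. Qed.

Lemma sinh_sqE : sinh r0 ^+ 2 = K / 4.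
Proof. by rewrite /sinh /K; field. Qed.

Lemma sinh_sq_expand (x : R) :
  sinh x ^+ 2 = (expR (2 * x) - 2 + expR (- (2 * x))) / 4.
Proof.
have e1 : expR (2 * x) = expR x ^+ 2 by rewrite -expRM_natl.
have e2 : expR (- (2 * x)) = expR (- x) ^+ 2 by rewrite -expRM_natl mulrN.
have e3 : expR x * expR (- x) = 1 by rewrite -expRD subrr expR0.
rewrite e1 e2 /sinh; move: (expR x) (expR (- x)) e3 => p q pq.
have -> : ((p - q) / 2) ^+ 2 = (p ^+ 2 - 2 * (p * q) + q ^+ 2) / 4 by field.
by rewrite pq mulr1.
Qed.

Let KE : K = expR (2 * r0) - 2 + expR (- (2 * r0)).
Proof. by have := sinh_sq_expand r0; rewrite sinh_sqE => H; lra. Qed.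

Lemma sinh_denominator : expR (2 * r0) / 2 <= K.
Proof.
rewrite KE; have := expR_ge1Dx (2 * r0); have := expR_gt0 (- (2 * r0)).
move=> y0 x1; have := xi1; have := r0xi; lra.
Qed.

Let K0 : 0 < K.
Proof. by apply: lt_le_trans sinh_denominator; rewrite divr_gt0. Qed.

Let Kinv : K^-1 <= 2 * expR (- (2 * r0)).
Proof.
have : K^-1 <= (expR (2 * r0) / 2)^-1.
  by rewrite lef_pV2 ?posrE ?divr_gt0//; exact: sinh_denominator.
by rewrite invf_div expRN.
Qed.

Lemma warp_factorE t : warp_factor r0 a t =
  expc (expR (2 * a) / K) (- (2 / K)) (expR (- (2 * a)) / K) t.
Proof.
have e1 : expR (2 * (t + a)) = expR (2 * t) * expR (2 * a).
  by rewrite -expRD; congr expR; ring.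
have e2 : expR (- (2 * (t + a))) = expR (- (2 * t)) * expR (- (2 * a)).
  by rewrite -expRD; congr expR; ring.
rewrite /warp_factor sinh_sqE sinh_sq_expand /expc e1 e2.
by field; rewrite gt_eqF.
Qed.

(** Since e^(2a) e^(2(r0 - a)) = e^(2 r0) differs from K by 2 - e^(-2 r0), the leading e^(2t)
    cancels, and every remaining coefficient carries 1/K. *)
Lemma warp_errorE t :
  warp_factor r0 a t * expR (2 * (r0 - a)) - expR (2 * t) =
  expc ((2 - expR (- (2 * r0))) / K) (- (2 * expR (2 * (r0 - a)) / K))
    (expR (2 * (r0 - a)) * expR (- (2 * a)) / K) t.
Proof.
rewrite warp_factorE /expc.
have -> : 2 - expR (- (2 * r0)) = expR (2 * a) * expR (2 * (r0 - a)) - K.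
  rewrite KE -expRD (_ : 2 * a + 2 * (r0 - a) = 2 * r0); first by ring.
  by ring.
by field; rewrite gt_eqF.
Qed.

(** Put X = e^(2(a + t)). As a + t > 0, the numerator 4 (X + 2 + 1/X) is at most 16 X; as a + t < r0
    + 1/2 + 2 xi, the quotient X/K is at most 2 e^(4 xi + 1). *)
Lemma C2_bounded_warp_factor m (U : set 'rV[R]_m.+1) : open U ->
  (forall z, U z -> 0 < tpart z + a /\ tpart z < xi) ->
  C2_bounded U (warp_factor r0 a \o @tpart R m) (32 * expR (4 * xi + 1)).
Proof.
have au := a_upper.
move=> Uo Ut; rewrite (_ : warp_factor r0 a = expc (expR (2 * a) / K) (- (2 / K))
  (expR (- (2 * a)) / K)); last by apply/funext => t; exact: warp_factorE.
apply: C2_bounded_expc => // z /Ut; set t := tpart z => -[t0 txi].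
have Ki0 : 0 < K^-1 by rewrite invr_gt0.
rewrite normrN !normrM !(gtr0_norm Ki0) !(gtr0_norm (expR_gt0 _)) (@ger0_norm _ 2)//.
have -> : 4 * (expR (2 * a) / K * expR (2 * t) + 2 / K
    + expR (- (2 * a)) / K * expR (- (2 * t))) =
    4 * (expR (2 * (a + t)) + 2 + expR (- (2 * (a + t)))) / K.
  have e1 : expR (2 * (a + t)) = expR (2 * t) * expR (2 * a).
    by rewrite -expRD; congr expR; ring.
  have e2 : expR (- (2 * (a + t))) = expR (- (2 * t)) * expR (- (2 * a)).
    by rewrite -expRD; congr expR; ring.
  by rewrite e1 e2; ring.
have X1 : 1 <= expR (2 * (a + t)) by apply: le_trans (expR_ge1Dx _); lra.
have Y1 : expR (- (2 * (a + t))) <= 1 by rewrite expR_le1; lra.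
have XK : expR (2 * (a + t)) / K <= 2 * expR (4 * xi + 1).
  apply: (@le_trans _ _ (expR (2 * (a + t)) * (2 * expR (- (2 * r0))))).
    by rewrite ler_wpM2l// expR_ge0.
  rewrite mulrCA ler_wpM2l// -expRD; apply: expR_mono; lra.
apply: (@le_trans _ _ (16 * (expR (2 * (a + t)) / K))); last by lra.
rewrite mulrA; apply: ler_wpM2r; first exact: ltW.
move: (expR _) (expR _) X1 Y1 => X Y X1 Y1; lra.
Qed.

(** Both e^(2t) and e^(2(r0 - a)) are at most Q = e^(2 + 2 xi), because t < xi and r0 - a < 1 + xi.
    The three terms of [expc] are then at most 4, 4 and 2 times Q e^(-2 r0), and 40 = 4 * (4 + 4 +
    2). *)
Lemma C2_bounded_warp_error m (U : set 'rV[R]_m.+1) : open U ->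
  (forall z, U z -> 0 < tpart z + a /\ tpart z < xi) ->
  C2_bounded U ((fun t => warp_factor r0 a t * expR (2 * (r0 - a)) - expR (2 * t))
    \o @tpart R m) (40 * expR (2 + 2 * xi) * expR (- (2 * r0))).
Proof.
have [x1 rx al] := And3 xi1 r0xi a_lower.
move=> Uo Ut; set u := expR (- (2 * r0)).
rewrite (_ : (fun t => _) = expc ((2 - u) / K) (- (2 * expR (2 * (r0 - a)) / K))
    (expR (2 * (r0 - a)) * expR (- (2 * a)) / K)); last first.
  by apply/funext => t; exact: warp_errorE.
apply: C2_bounded_expc => // z /Ut; set t := tpart z => -[t0 txi].
have Ki0 : 0 < K^-1 by rewrite invr_gt0.
have u0 : 0 < u := expR_gt0 _.
have u1 : u <= 1 by rewrite /u expR_le1; lra.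
rewrite normrN !normrM !(gtr0_norm Ki0) !(gtr0_norm (expR_gt0 _)) (@ger0_norm _ 2)//.
rewrite (@ger0_norm _ (2 - u)); last by lra.
set Q := expR (2 + 2 * xi).
have Q0 : 0 < Q := expR_gt0 _.
have k1 : (2 - u) / K * expR (2 * t) <= 4 * Q * u.
  apply: (@le_trans _ _ (2 * (2 * u) * Q)); last by lra.
  have h : (2 - u) / K <= 2 * (2 * u).
    by apply: ler_pM; [lra|exact: ltW|lra|exact: Kinv].
  apply: ler_pM => //; [by rewrite mulr_ge0 ?(ltW Ki0)//; lra|].
  by apply: expR_mono; lra.
have eb : expR (2 * (r0 - a)) / K <= 2 * (Q * u).
  apply: (@le_trans _ _ (expR (2 * (r0 - a)) * (2 * u))).
    by rewrite ler_wpM2l// expR_ge0.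
  rewrite mulrCA ler_wpM2l// (ler_wpM2r (ltW u0))//; apply: expR_mono; lra.
have k2 : 2 * expR (2 * (r0 - a)) / K <= 4 * Q * u by rewrite -mulrA; lra.
have k3 : expR (2 * (r0 - a)) * expR (- (2 * a)) / K * expR (- (2 * t)) <= 2 * (Q * u).
  apply: le_trans eb.
  rewrite -!mulrA ler_wpM2l ?expR_ge0// mulrCA -[leRHS]mulr1 (ler_wpM2l (ltW Ki0))//.
  by rewrite -expRD ltW// expR_lt1; lra.
lra.
Qed.

End Numbers.

(** The argument 2(t + a) - 2 r0 has slope 2, so the second derivative picks up a factor 4. *)
Lemma C2_bounded_cutoff (rho drho d2rho : R -> R) (a r0 C : R) m
    (U : set 'rV[R]_m.+1) : open U -> 1 <= C ->
  (forall t, is_derive t (1 : R) rho (drho t)) ->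
  (forall t, is_derive t (1 : R) drho (d2rho t)) ->
  (forall t, `|rho t| <= 1) -> (forall t, `|drho t| <= C) ->
  (forall t, `|d2rho t| <= C) ->
  C2_bounded U ((fun t => rho (2 * (t + a) - 2 * r0)) \o @tpart R m) (4 * C).
Proof.
move=> Uo C1 h1 h2 b0 b1 b2.
have dA t : is_derive t (1 : R) (fun t => 2 * (t + a) - 2 * r0) 2.
  have dd := is_deriveB (is_deriveZ (2 : R)
    (is_deriveD (is_derive_id t (1 : R)) (is_derive_cst a t 1)))
    (is_derive_cst (2 * r0) t (1 : R)).
  by apply: is_derive_eq dd _; rewrite addr0 subr0 /GRing.scale /= mulr1.
have dC (f df : R -> R) t : (forall s, is_derive s (1 : R) f (df s)) ->
    is_derive t (1 : R) (fun t => f (2 * (t + a) - 2 * r0)) (2 * df (2 * (t + a) - 2 * r0)).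
  move=> hf; have dd := @is_derive1_comp _ f _ t _ _ (hf _) (dA t).
  by apply: is_derive_eq dd _; rewrite mulrC.
have dC2 t := is_deriveZ (2 : R) (dC _ _ t h2).
apply: (C2_bounded_tpart Uo (fun t => dC _ _ t h1) dC2).
move=> z _; set s := _ - _; have := b0 s; have := b1 s; have := b2 s.
rewrite !normrM (@ger0_norm _ 2)//.
by split; lra.
Qed.

(* Since 1 < xi, the constant exp(32 + 4 xi) is below exp(27 + 12 xi). *)
Lemma final_constant (xi u eps : R) : 0 <= u -> 0 <= eps -> 1 < xi ->
  4 * (4 * (216 * expR 10)) * (4 * (32 * expR (4 * xi + 1)) * eps
     + 40 * expR (2 + 2 * xi) * u) + 4 * (4 * (216 * expR 10)) * eps
  <= expR (32 + 4 * xi) * (u + eps).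
Proof.
move=> u0 e0 xi1.
have -> : expR (32 + 4 * xi) = expR 10 * expR 10 * expR 10 * expR (4 * xi + 2).
  by rewrite -!expRD; congr expR; ring.
set X := expR (4 * xi + 2).
have D10 := expR10_ge; set D : R := expR 10 in D10 *.
have X1 : 1 <= X by apply: le_trans (expR_ge1Dx _); lra.
have t1 : expR (4 * xi + 1) * eps <= X * eps by rewrite ler_wpM2r//; apply: expR_mono; lra.
have t2 : expR (2 + 2 * xi) * u <= X * u by rewrite ler_wpM2r//; apply: expR_mono; lra.
have t3 : 1 * eps <= X * eps by rewrite ler_wpM2r.
have Xu : 0 <= X * u by rewrite mulr_ge0//; lra.
have Xe : 0 <= X * eps by rewrite mulr_ge0//; lra.
clearbody D X.
move: (expR (4 * xi + 1)) (expR (2 + 2 * xi)) t1 t2 => e1 e2 t1 t2.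
(* 169 is 128 + 40 + 1, one summand for each term on the left. *)
have b1 : 4 * (32 * e1) * eps + 40 * e2 * u + eps
    <= 169 * (X * (u + eps)) by lra.
rewrite [leLHS](_ : _ = 3456 * D * (4 * (32 * e1) * eps + 40 * e2 * u + eps)); last by ring.
apply: (@le_trans _ _ (3456 * D * (169 * (X * (u + eps))))).
  by apply: ler_wpM2l; [lra|exact: b1].
(* 3456 * 169 = 864 * 676, and each of these two factors is below 1024, hence below D = e^10. The
   product is thus absorbed by two of the three powers of D. *)
rewrite (_ : 3456 * D * _ = 864 * D * 676 * (X * (u + eps))); last by ring.
rewrite -(mulrA _ X); apply: ler_wpM2r; first by rewrite mulrDr addr_ge0.
rewrite mulrAC -mulrA -(mulrA D); apply: ler_pM; [lra| |lra|].
  by apply: mulr_ge0; lra.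
by rewrite mulrC; apply: ler_wpM2l; lra.
Qed.

End Estimates.

(** * The main estimate *)

Lemma mx_sub_entry (R : pzRingType) n (A B : 'M[R]_n) i j :
  (A - B) i j = A i j - B i j.
Proof. by rewrite !mxE. Qed.

(** The weights 1 - w and w sum to 1, so the hyperbolic entry can be subtracted inside each of them.
    In the last row and column the warped metric and the model agree exactly. Elsewhere the error
    splits into closeness on the slice, scaled by s, and the mismatch s * eb - e of the diagonal
    factors. *)
Lemma warp_entry_algebra (R : comPzRingType) (T : eqType) (i j k : T)
    (w G Gb s e eb : R) :
  let hyp x := if i == j then if i == k then 1 else x else 0 in
  (1 - w) * (if (i == k) || (j == k) then ((i == k) && (j == k))%:R else s * Gb)
    + w * G - hyp e =
  (1 - w) * (if (i == k) || (j == k) then 0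
             else s * (Gb - hyp eb) + (if i == j then s * eb - e else 0))
    + w * (G - hyp e).
Proof.
rewrite /=; case: (eqVneq i k) => [->|ik] /=.
  by rewrite (eq_sym k); case: (eqVneq j k) => _ /=; ring.
case: (eqVneq j k) => [->|jk] /=; first by rewrite (negPf ik); ring.
by case: eqP => _; ring.
Qed.

Section MainEstimate.
Variable R : realType.

Lemma hyperbolicE m (z : 'rV[R]_m.+1) i j : hyperbolic z i j =
  if i == j then if i == ord_max then 1 else expR (2 * tpart z) else 0.
Proof. by rewrite mxE. Qed.

Lemma ck_hyperbolic m (xi : R) (i j : 'I_m.+1) :
  ck 1 (model xi) (fun z => hyperbolic z i j).
Proof.
have Uo := @open_model R m xi.
pose f : 'rV[R]_m.+1 -> R := if i == j then if i == ord_max then cst 1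
  else expc 1 0 0 \o @tpart R m else cst 0.
apply: (@ck_ext _ _ _ Uo _ f).
  move=> z _; rewrite hyperbolicE /f; case: eqP => // _; case: eqP => // _.
  by rewrite /expc /=; ring.
rewrite /f; case: eqP => _; last exact: ck_cst.
case: eqP => _; first exact: ck_cst.
(* Only the [ck 1] component is extracted; the bound just has to be valid on the model, where t < 1
   + xi. *)
have [] // := @C2_bounded_expc R m (model xi) 1 0 0 (4 * expR (2 * (1 + xi))) Uo _.
move=> z [_ /andP[_ tz]]; rewrite normr1 normr0 mul1r mul0r !addr0.
by apply: ler_wpM2l => //; apply: expR_mono; lra.
Qed.

(** Both weights take values in [0, 1] and have the same derivatives up to sign, so treating 1 -
    [step] as a cutoff profile of its own gives the same constant. *)
Lemma C2_bounded_step m (U : set 'rV[R]_m.+1) (a r0 : R) : open U ->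
  C2_bounded U ((fun t => step (2 * (t + a) - 2 * r0)) \o @tpart R m)
    (4 * (216 * expR 10)) /\
  C2_bounded U ((fun t => 1 - step (2 * (t + a) - 2 * r0)) \o @tpart R m)
    (4 * (216 * expR 10)).
Proof.
move=> Uo; have C1 : (1 : R) <= 216 * expR 10 by have := @expR10_ge R; lra.
have b1 t := @dstep_bound R t; have b2 t := @d2step_bound R t.
have d1 t := @is_derive_step R t; have d2 t := @is_derive_dstep R t.
split.
  apply: (C2_bounded_cutoff _ _ Uo C1 d1 d2) => // t.
  by have /andP[s0 s1] := step_range t; rewrite ger0_norm.
have d1' t : is_derive t (1 : R) (fun t => 1 - step t) (- dstep t).
  apply: is_derive_eq (is_deriveB (is_derive_cst (1 : R) t (1 : R)) (d1 t)) _.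
  by rewrite sub0r.
have d2' t : is_derive t (1 : R) (fun t => - dstep t) (- d2step t).
  exact: is_deriveN.
apply: (@C2_bounded_cutoff _ (fun t => 1 - step t) _ _ a r0 _ _ _ Uo C1 d1' d2') => // t.
- by have /andP[s0 s1] := step_range t; rewrite ger0_norm; lra.
- by rewrite normrN.
- by rewrite normrN.
Qed.

Section Chart.
Variables (m : nat) (M : manifold R m.+1) (g : tensor M) (o : M).
Variables (E : 'rV[R]_m.+1 -> M) (L : M -> 'rV[R]_m.+1).
Variables (xi r0 a eps : R) (phi : 'rV[R]_m.+1 -> M) (psi : M -> 'rV[R]_m.+1).
Variable (phi1 : 'rV[R]_m -> 'rV[R]_m.+1).
Hypothesis gR : riemannian_metric g.
Hypothesis EK : forall v, L (E v) = v.
Hypothesis phi_diffeo : diffeo (model xi) (phi @` model xi) phi psi.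
Hypothesis phi1_unit : forall x : 'rV[R]_m, unit_ball x -> tangent_norm g o (phi1 x) = 1.
Hypothesis phi_radial : forall z : 'rV[R]_m.+1, model xi z ->
  0 < tpart z + a /\ phi z = E ((tpart z + a) *: phi1 (xpart z)).
Hypothesis phi_close :
  (C2norm (model xi) (fun z => pullback phi g z - hyperbolic z)%R < eps%:E)%E.
Hypotheses (xi1 : 1 < xi) (r0xi : 3 + 2 * xi <= r0) (a_lower : r0 - 1 - xi < a).

Let U : set 'rV[R]_m.+1 := model xi.
Let U' : set 'rV[R]_m.+1 := model (xi - 1).

Let H i j (z : 'rV[R]_m.+1) : R := (pullback phi g z - hyperbolic z) i j.

Let Uo : open U. Proof. exact: open_model. Qed.
Let U'o : open U'. Proof. exact: open_model. Qed.

Lemma model_subset : (model (xi - 1) : set 'rV[R]_m.+1) `<=` model xi.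
Proof. by move=> z [Uz /andP[t1 t2]]; split=> //; apply/andP; split; lra. Qed.

Let HE i j z : H i j z = pullback phi g z i j - hyperbolic z i j.
Proof. exact: mx_sub_entry. Qed.

Lemma C2_bounded_close i j : C2_bounded U (H i j) eps.
Proof.
apply: C2norm_lt_bounded phi_close; have [_ _ sg] := gR.
have cp : ck 1 U (fun z => pullback phi g z i j).
  by apply: ck_pullback => //; case: phi_diffeo => _ _ _ _ [].
have cm : ck 1 U (cst (-1) \* (fun z : 'rV[R]_m.+1 => hyperbolic z i j)).
  by apply: (ck_mul Uo); [exact: ck_cst|exact: ck_hyperbolic].
apply: (ck_ext Uo) (ck_add Uo cp cm) => z _.
by rewrite /= -/(H i j z) HE mulN1r.
Qed.

Lemma model0 (x : R) : 1 < x -> model x (0 : 'rV[R]_m.+1).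
Proof.
move=> x1; split; last by rewrite /tpart mxE; apply/andP; split; lra.
rewrite /unit_ball /= big1 ?ltr01// => j _.
by rewrite !mxE expr0n.
Qed.

(** The model contains the origin, so eps dominates an absolute value there. *)
Lemma eps_ge0 : 0 <= eps.
Proof.
have [_ /(_ 0 (model0 xi1)) [h _ _]] := C2_bounded_close ord_max ord_max.
exact: le_trans h.
Qed.

Let constE := expR (32 + 4 * xi) * (expR (- (2 * r0)) + eps).

Lemma eps_le_const : eps <= constE.
Proof.
have e0 := eps_ge0; have u0 := expR_gt0 (- (2 * r0)).
have C1 : 1 <= expR (32 + 4 * xi).
  by apply: le_trans (expR_ge1Dx _); have := xi1; lra.
rewrite /constE; apply: (@le_trans _ _ (1 * (expR (- (2 * r0)) + eps))); first by lra.
by apply: ler_wpM2r => //; lra.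
Qed.

Lemma warp_forced_far i j : r0 + 2^-1 + xi <= a ->
  C2_bounded U' (fun z => (pullback phi (warp_forced (@step R) g o E L r0) z - hyperbolic z) i j)
    constE.
Proof.
move=> far; apply: C2_bounded_le eps_le_const _.
apply: (C2_bounded_ext U'o) (C2_bounded_subset model_subset (C2_bounded_close i j)).
move=> z; rewrite inE => U'z; have Uz := model_subset U'z.
rewrite HE mx_sub_entry; congr (_ - _).
have [_ /andP[t1 t2]] := U'z.
have w1 : step (2 * radius g o L (phi z) - 2 * r0) = 1.
  rewrite (radius_chart EK phi1_unit phi_radial Uz); apply: step1; lra.
have Wg : warp_forced (@step R) g o E L r0 (phi z) = g (phi z).
  by rewrite /warp_forced w1 subrr scale0r add0r scale1r.
by rewrite /pullback Wg.
Qed.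

Lemma warp_forced_near i j : a < r0 + 2^-1 + xi ->
  C2_bounded U' (fun z => (pullback phi (warp_forced (@step R) g o E L r0) z - hyperbolic z) i j)
    constE.
Proof.
move=> near.
have b_range : - 1 - xi < r0 - a < 1 + xi by have := a_lower; have := xi1; lra.
pose b := r0 - a.
have [wB cwB] := @C2_bounded_step m U' a r0 U'o.
set w := (fun t => step _) \o _ in wB.
set cw := (fun t => 1 - step _) \o _ in cwB.
have t_range z : U' z -> 0 < tpart z + a /\ tpart z < xi.
  move=> U'z; have [t0 _] := phi_radial (model_subset U'z).
  by split=> //; have [_ /andP[]] := U'z; lra.
have e0 := eps_ge0; have u0 := expR_gt0 (- (2 * r0)).
have HB : C2_bounded U' (H i j) eps.
  exact: C2_bounded_subset model_subset (C2_bounded_close i j).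
have HsB : C2_bounded U' (H i j \o slice b) eps.
  apply: C2_bounded_slice (C2_bounded_close i j) => // z U'z.
  exact: (slice_model b_range (model_subset U'z)).
have SB := C2_bounded_warp_factor xi1 r0xi near U'o t_range.
have QB := C2_bounded_warp_error xi1 r0xi a_lower U'o t_range.
set S := warp_factor r0 a \o _ in SB.
set Q0 := (fun t => _) \o _ in QB.
(* Replacing e^(2b) by e^(2t) costs something only on the diagonal: off it the hyperbolic metric
   vanishes on every slice. *)
pose Q : 'rV[R]_m.+1 -> R := if i == j then Q0 else cst 0.
have QB' : C2_bounded U' Q (40 * expR (2 + 2 * xi) * expR (- (2 * r0))).
  rewrite /Q; case: eqP => _; first exact: QB.
  apply: C2_bounded_le (C2_bounded_cst 0 U'o); rewrite normr0.
  by apply: mulr_ge0 (expR_ge0 _); apply: mulr_ge0 (expR_ge0 _).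
have wHB := C2_bounded_mul U'o wB HB.
have TB := C2_bounded_add U'o (C2_bounded_mul U'o cwB
  (C2_bounded_add U'o (C2_bounded_mul U'o SB HsB) QB')) wHB.
have final := final_constant (ltW u0) e0 xi1.
have wHle : 4 * (4 * (216 * expR 10)) * eps <= constE.
  apply: le_trans final; rewrite lerDr.
  by rewrite !mulr_ge0// addr_ge0// !mulr_ge0// expR_ge0.
have formula z : U' z ->
    (pullback phi (warp_forced (@step R) g o E L r0) z - hyperbolic z) i j =
    cw z * (if (i == ord_max) || (j == ord_max) then 0
            else S z * H i j (slice b z) + Q z) + w z * H i j z.
  move=> U'z; have Uz := model_subset U'z.
  rewrite mx_sub_entry.
  have := pullback_warp_forced EK phi_diffeo phi1_unit phi_radial b_range (@step R) i j Uz.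
  move=> /= ->.
  have QE : Q z = if i == j then
      warp_factor r0 a (tpart z) * expR (2 * b) - expR (2 * tpart z) else 0.
    by rewrite /Q; case: eqP.
  rewrite QE !HE !hyperbolicE tpart_slice.
  exact: warp_entry_algebra.
(* In the last row and column the factor of 1 - w vanishes, and only the product of w with the
   original error remains. *)
have [ij|ij] := boolP ((i == ord_max) || (j == ord_max)).
  apply: C2_bounded_le wHle _.
  apply: (C2_bounded_ext U'o) wHB => z; rewrite inE => U'z.
  by rewrite formula// ij /= mulr0 add0r.
apply: C2_bounded_le final _.
apply: (C2_bounded_ext U'o) TB => z; rewrite inE => U'z.
by rewrite formula// (negPf ij).
Qed.

Lemma warp_forced_close eta :
  expR (27 + 12 * xi) * (expR (- (2 * r0)) + eps) <= eta ->
  (C2norm (model (xi - 1))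
     (fun z => pullback phi (warp_forced (@step R) g o E L r0) z - hyperbolic z)%R
   < eta%:E)%E.
Proof.
move=> le_eta.
have bd i j : C2_bounded U'
    (fun z => (pullback phi (warp_forced (@step R) g o E L r0) z - hyperbolic z) i j) constE.
  have [far|near] := leP (r0 + 2^-1 + xi) a; first exact: warp_forced_far.
  exact: warp_forced_near.
apply: le_lt_trans (C2norm_le bd) _; rewrite lte_fin.
(* Pointwise bounds give only a large inequality for the supremum; the strict gap between the two
   exponential constants, multiplied by e^(-2 r0) + eps > 0, restores the strict one. *)
apply: lt_le_trans le_eta; rewrite /constE ltr_pM2r.
  by rewrite ltr_expR; have := xi1; lra.
by rewrite ltr_pwDl ?expR_gt0 ?eps_ge0.
Qed.

End Chart.
End MainEstimate.

Theorem mainTheorem1 (R : realType) :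
  exists rho : R -> R, cutoff rho /\
  forall (xi r0 : R), 1 < xi -> 3 + 2 * xi <= r0 ->
  forall (m : nat) (M : manifold R m.+1) (g : tensor M) (o : M)
         (E : 'rV[R]_m.+1 -> M) (L : M -> 'rV[R]_m.+1),
    riemannian_metric g -> complete_metric g -> has_center g o E L ->
  forall (S : set M) (eps eta : R),
    radially_close g o E g S xi eps ->
    expR (27 + 12 * xi) * (expR (- (2 * r0)) + eps) <= eta ->
    radially_close g o E (warp_forced rho g o E L r0)
      (S `\` closed_gball g o (r0 - 1 - xi)) (xi - 1) eta.
Proof.
exists (@step R); split; first exact: cutoff_step.
move=> xi r0 xi1 r0xi m M g o E L gR gC [expE [_ _ _ EK' _]] S eps eta close le_eta.
have EK v : L (E v) = v by exact: EK'.
move=> p [Sp far]; have [phi [psi [a [phi1 chart]]]] := close p Sp.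
have [dif phi0 unit1 rad closeC] := chart.
have sub := @model_subset R m xi.
have a_lower : r0 - 1 - xi < a.
  rewrite ltNge; apply/negP => a_le; apply: far.
  have U0 := model0 m xi1; have [a0 pE] := rad 0 U0.
  have t0 : tpart (0 : 'rV[R]_m.+1) = 0 by rewrite /tpart mxE.
  rewrite t0 add0r in a0 pE.
  rewrite /closed_gball /= -phi0 pE.
  apply: le_trans (riemannian_dist_exponential gR _ gC expE) _.
  rewrite lee_fin (tangent_normZ _ _ _ (ltW a0)) unit1 ?mulr1//.
  by case: U0.
exists phi, psi, a, phi1; split => //.
- by apply: (diffeo_restrict dif); [exact: open_model|exact: sub].
- by move=> z /sub; exact: rad.
- exact: (warp_forced_close gR EK dif unit1 rad closeC).
Qed.
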